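(* Let $T$ be an arbitrary tetrahedron and let $R_T$ be defined by $R_T:=\dfrac{h_1h_2h_T}{|T|}\,h_T$. Then $T$ satisfies the maximum angle condition with $\theta_{\max}\in[\pi/2,\pi)$ if and only if there exists a fixed constant $D=D(\theta_{\max})$ such that $$\frac{R_T}{h_T}\le D.$$
   Context: $T\subset\mathbb{R}^3$ denotes a tetrahedron (a closed set) and $|T|$ its volume. Let $h_i$ $(i=1,\dots,6)$ be the lengths of the edges of $T$, ordered so that $h_1\le\cdots\le h_6=h_T:=\operatorname{diam}T$; these are the quantities appearing in the definition of $R_T$. Maximum angle condition: let $\theta_{\max}$ be a constant with $\pi/2\le\theta_{\max}<\pi$. A tetrahedron $T$ is said to satisfy the maximum angle condition with $\theta_{\max}$ if all inner angles of the faces of $T$, and all dihedral angles between two faces of $T$, are less than or equal to $\theta_{\max}$. *)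

(* Defs.v *)
(* MathComp / MathComp-Analysis. *)
From HB Require Import structures.
From mathcomp Require Import all_boot all_order all_algebra.
From mathcomp Require Import all_classical all_reals all_analysis.

Set Implicit Arguments.
Unset Strict Implicit.
Unset Printing Implicit Defensive.

Import Order.TTheory GRing.Theory Num.Theory.

Local Open Scope classical_set_scope.
Local Open Scope ring_scope.

(* The library norm on 'rV[R]_3 is the sup norm, hence the explicit Euclidean
   one. *)
Definition dot (R : realType) (u v : 'rV[R]_3) : R := \sum_(i < 3) u 0 i * v 0 i.

Definition enorm (R : realType) (u : 'rV[R]_3) : R := Num.sqrt (dot u u).

Definition dist (R : realType) (x y : 'rV[R]_3) : R := enorm (x - y).

Definition diam (R : realType) (A : set 'rV[R]_3) : R :=
  sup [set dist x y | x in A & y in A].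

(* Lebesgue measure on R^3, transported from R * R * R, where the library has
   the product measure, to row vectors. *)
Definition of_coords (R : realType) (q : R * R * R) : 'rV[R]_3 :=
  \row_(i < 3) [:: q.1.1; q.1.2; q.2]`_i.

Definition volume (R : realType) (A : set 'rV[R]_3) : R :=
  fine (((@lebesgue_measure R \x @lebesgue_measure R)
           \x @lebesgue_measure R)%E (@of_coords R @^-1` A)).

(* A tetrahedron is given by four affinely independent vertices. *)
Record tetrahedron (R : realType) := Tetrahedron {
  vertex : 'I_4 -> 'rV[R]_3;
  vertex_free :
    row_free (\matrix_(i < 3) (vertex (lift ord0 i) - vertex ord0)) }.

Definition tetra_set (R : realType) (T : tetrahedron R) : set 'rV[R]_3 :=
  [set x | exists w : 'I_4 -> R,
     [/\ forall i, 0 <= w i, \sum_(i < 4) w i = 1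
       & x = \sum_(i < 4) w i *: vertex T i]].

(* Nondecreasing; being 0-indexed, its i-th entry is h_(i+1). *)
Definition edge_lengths (R : realType) (T : tetrahedron R) : seq R :=
  sort <=%R [seq dist (vertex T e.1) (vertex T e.2)
               | e <- enum [pred e : 'I_4 * 'I_4 | (e.1 < e.2)%N]].

Definition h1 (R : realType) (T : tetrahedron R) : R := (edge_lengths T)`_0.
Definition h2 (R : realType) (T : tetrahedron R) : R := (edge_lengths T)`_1.
Definition hT (R : realType) (T : tetrahedron R) : R := diam (tetra_set T).

Definition RT (R : realType) (T : tetrahedron R) : R :=
  h1 T * h2 T * hT T / volume (tetra_set T) * hT T.

Definition angle (R : realType) (u v : 'rV[R]_3) : R :=
  acos (dot u v / (enorm u * enorm v)).

(* Inner angle, at the vertex i, of the face with vertices i, j, k. *)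
Definition face_angle (R : realType) (T : tetrahedron R) (i j k : 'I_4) : R :=
  angle (vertex T j - vertex T i) (vertex T k - vertex T i).

(* Component of v orthogonal to e. *)
Definition orth_part (R : realType) (e v : 'rV[R]_3) : 'rV[R]_3 :=
  v - (dot v e / dot e e) *: e.

(* Angle between the faces i, j, k and i, j, l, which meet along the edge
   i, j: it is measured in a plane orthogonal to that edge, between the rays
   along which this plane cuts the two faces. *)
Definition dihedral_angle (R : realType) (T : tetrahedron R)
    (i j k l : 'I_4) : R :=
  let e := vertex T j - vertex T i in
  angle (orth_part e (vertex T k - vertex T i))
        (orth_part e (vertex T l - vertex T i)).

Definition max_angle_condition (R : realType) (theta : R)
    (T : tetrahedron R) : Prop :=
  (forall i j k : 'I_4, uniq [:: i; j; k] -> face_angle T i j k <= theta) /\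
  (forall i j k l : 'I_4, uniq [:: i; j; k; l] ->
     dihedral_angle T i j k l <= theta).

(* Main.v *)
From HB Require Import structures.
Require Import Defs.
From mathcomp Require Import all_boot all_order all_algebra.
From mathcomp Require Import ring lra zify.
From mathcomp Require Import all_classical all_reals all_analysis.
From mathcomp Require Import measurable_realfun.

(** Write [W] for the volume of the parallelepiped spanned by the edges of [T]
    at a vertex, the absolute value of a triple product ([span_volume]).  Up to
    constants the ratio is [h1 * h2 * hT / W]: the tetrahedron lies inside that
    parallelepiped and contains a copy of it scaled by 1/3 ([volume_bounds]), and
    its diameter lies between the longest edge at a vertex and twice that length ([hT_ub],
    [dist_le_hT]).  Both directions are then statements about the triple product.

    A bounded ratio bounds the angles.  Only an obtuse angle has to be bounded.
    For a face angle between edges [p] and [q], [W] is at most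
    [|p| |q| m sin], with [m] the smallest distance of the fourth vertex to the
    vertices of the face; for a dihedral angle along [e], [W] is [|e| r s sin],
    with [r] and [s] the distances of the two other vertices to the line
    of [e].  Because the angle is obtuse, the side opposite to it is the longest
    one of its triangle, and a look at the positions of the two shortest edges
    shows that [|p| |q| m] and [|e| r s] are at most [2 * h1 * h2 * hT]
    ([obtuse_face_product], [obtuse_dihedral_product]).  Hence a bound
    [h1 * h2 * hT <= D * W] forces [sin >= 1 / (2 * D)], and the angle stays away
    from pi ([face_angle_le_of_ratio], [dihedral_angle_le_of_ratio]).

    Bounded angles bound the ratio.  Let [- k], with [k < 1], be a lower bound of
    the cosines.  In a triangle the largest angle is at least pi / 3 and bounded
    away from pi, so that the area is comparable with the product of the shortest
    and the longest side ([triangle_area]).  At a vertex, the dihedral angles are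
    supplements of the angles between the normals of the three faces.  No two
    outward normals nearly coincide, so a normal cannot be nearly opposite to
    both others ([antipodal_normals]): of two edges at a vertex, one has
    a dihedral angle whose sine is bounded below.  Apply this to the two edges at
    a vertex [o] other than the shortest one [oi], and let [e] be the good edge.
    From [W * |e| = A1 * A2 * sin], where [A1] and [A2] are the doubled areas of
    the faces meeting at [e], one gets [W >= c * a1 * a2 * C], where [a1], [a2] are
    the shortest sides of these faces and [C] is their longest side.  Choosing the
    face of [A1] to be the one containing [oi], which is no longer than [e], gives
    [h1 * h2 <= a1 * a2], and [hT <= 2 * C] ([ratio_le_of_good_edge]).

    The volume of a parallelepiped is computed by elimination: a transformation
    adding to one coordinate a linear function of the two others preserves
    the Lebesgue measure by Fubini and translation invariance, and such
    transformations make any invertible 3 x 3 matrix diagonal with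
    the same determinant ([triple_neq0_diagonalizable], [simplex_volume]). *)

Set Implicit Arguments.
Unset Strict Implicit.
Unset Printing Implicit Defensive.

Import Order.TTheory GRing.Theory Num.Theory.

Local Open Scope classical_set_scope.
Local Open Scope ring_scope.

(** * Shears and the volume of a simplex *)

Definition measure_preserving d (T : measurableType d) (R : realType)
    (m : set T -> \bar R) (f : T -> T) :=
  measurable_fun setT f /\
  forall A, measurable A -> m (f @^-1` A) = m A.

Lemma measure_preserving_comp d (T : measurableType d) (R : realType)
    (m : set T -> \bar R) (f g : T -> T) :
  measure_preserving m f -> measure_preserving m g ->
  measure_preserving m (g \o f).
Proof.
move=> [mf fE] [mg gE]; split; first exact: measurableT_comp.
move=> A mA; rewrite comp_preimage fE ?gE//.
by rewrite -[_ @^-1` _]setTI; exact: mg.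
Qed.

(** Lebesgue measure is determined by its values on half-open intervals, whose
    length does not change under translation. *)
Lemma measure_preserving_translation (R : realType) (c : R) :
  measure_preserving (@lebesgue_measure R) (fun x => x + c).
Proof.
have mf : measurable_fun setT (fun x : R => x + c) by exact: measurable_funD.
split=> // A mA.
pose f : measurableTypeR R -> measurableTypeR R := fun x => x + c.
rewrite -[LHS]/(pushforward lebesgue_measure f A).
apply/esym/lebesgue_measure_unique => //= _ [[a b]] _ <-.
rewrite /pushforward/=.
rewrite (_ : f @^-1` _ = `]a - c, b - c]%classic); last first.
  by apply/seteqP; split=> x /=; rewrite /f !in_itv/= ltrBlDr lerBrDr.
rewrite !lebesgue_measure_itv/= !lte_fin ltrD2r.
case: ifP => // _; rewrite -!EFinB; congr (_%:E); ring.
Qed.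

(** The product measure integrates the measures of the sections, and here each
    section is moved by a measure-preserving map. *)
Lemma measure_preserving_fibre d1 d2 (T1 : measurableType d1)
    (T2 : measurableType d2) (R : realType) (m1 : set T1 -> \bar R)
    (m2 : set T2 -> \bar R) (phi : T1 -> T2 -> T2) :
  measurable_fun setT (fun q : T1 * T2 => (q.1, phi q.1 q.2)) ->
  (forall x, measure_preserving m2 (phi x)) ->
  measure_preserving (m1 \x m2)%E (fun q : T1 * T2 => (q.1, phi q.1 q.2)).
Proof.
move=> mf fE; split=> // A mA; rewrite /product_measure1.
congr (integral _ _ _); apply/funext => x /=.
rewrite -(proj2 (fE x) (xsection A x)); last exact: measurable_xsection.
by congr (m2 _); apply/seteqP; split=> y /=; rewrite /xsection/= !inE.
Qed.

(** The mirror image of [measure_preserving_fibre]; sections in the other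
    direction compute the same measure only for sigma-finite factors. *)
Lemma measure_preserving_cofibre d1 d2 (T1 : measurableType d1)
    (T2 : measurableType d2) (R : realType)
    (m1 : {sigma_finite_measure set T1 -> \bar R})
    (m2 : {sigma_finite_measure set T2 -> \bar R}) (phi : T2 -> T1 -> T1) :
  measurable_fun setT (fun q : T1 * T2 => (phi q.2 q.1, q.2)) ->
  (forall y, measure_preserving m1 (phi y)) ->
  measure_preserving (m1 \x m2)%E (fun q : T1 * T2 => (phi q.2 q.1, q.2)).
Proof.
move=> mf fE; split=> // A mA.
have E2 B : measurable B -> (m1 \x m2)%E B = (m1 \x^ m2)%E B.
  by apply: product_measure_unique => //= *; rewrite product_measure2E.
rewrite !E2//; last by rewrite -[_ @^-1` _]setTI; exact: mf.
rewrite /product_measure2.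
congr (integral _ _ _); apply/funext => y /=.
rewrite -(proj2 (fE y) (ysection A y)); last exact: measurable_ysection.
by congr (m1 _); apply/seteqP; split=> x /=; rewrite /ysection/= !inE.
Qed.

(** A name for Lebesgue measure on the plane, to which its sigma-finiteness can
    be attached for [measure_preserving_cofibre]. *)
Definition plane_measure (R : realType) :=
  (@lebesgue_measure R \x @lebesgue_measure R)%E.

HB.instance Definition _ (R : realType) := Measure.on (@plane_measure R).

Lemma plane_measure_sigma_finite (R : realType) :
  sigma_finite setT (@plane_measure R).
Proof.
have [F TF Fm] := sigma_finiteT (@lebesgue_measure R).
(* the rectangles of pieces of finite length, indexed by a coding of pairs *)
pose G n := if unpickle n is Some (i, j) then F i `*` F j else set0.
exists G.
  apply/seteqP; split=> // -[x y] _.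
  have [i _ Fix] : (\bigcup_i F i) x by rewrite -TF.
  have [j _ Fjy] : (\bigcup_i F i) y by rewrite -TF.
  by exists (pickle (i, j)) => //; rewrite /G pickleK.
move=> n; rewrite /G; case: (unpickle n) => [[i j]|]; last first.
  by rewrite measure0; split.
have [mi fi] := Fm i; have [mj fj] := Fm j.
split; first exact: measurableX.
by rewrite [_ (_ `*` _)]product_measure1E// lte_mul_pinfty// ge0_fin_numE.
Qed.

HB.instance Definition _ (R : realType) :=
  Measure_isSigmaFinite.Build _ _ _ (@plane_measure R)
    (@plane_measure_sigma_finite R).

Section Space.
Variable R : realType.
Notation space := (R * R * R)%type.
Notation lebesgue3 :=
  ((@lebesgue_measure R \x @lebesgue_measure R) \x @lebesgue_measure R)%E.

Definition shear_x (s t : R) (q : space) : space :=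
  (q.1.1 + (s * q.1.2 + t * q.2), q.1.2, q.2).
Definition shear_y (s t : R) (q : space) : space :=
  (q.1.1, q.1.2 + (s * q.1.1 + t * q.2), q.2).
Definition shear_z (s t : R) (q : space) : space :=
  (q.1.1, q.1.2, q.2 + (s * q.1.1 + t * q.1.2)).

Let measurable_coord1 : measurable_fun setT (fun q : space => q.1.1).
Proof. by apply: measurableT_comp => //; exact: measurable_fst. Qed.
Let measurable_coord2 : measurable_fun setT (fun q : space => q.1.2).
Proof. by apply: measurableT_comp => //; exact: measurable_snd. Qed.
Let measurable_coord3 : measurable_fun setT (fun q : space => q.2).
Proof. exact: measurable_snd. Qed.

Let measurable_shift (f g h : space -> R) (s t : R) :
  measurable_fun setT f -> measurable_fun setT g -> measurable_fun setT h ->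
  measurable_fun setT (fun q => h q + (s * f q + t * g q)).
Proof.
move=> mf mg mh; apply: measurable_funD => //.
by apply: measurable_funD; apply: measurable_funM.
Qed.

Lemma measure_preserving_shear_z s t :
  measure_preserving lebesgue3 (shear_z s t).
Proof.
rewrite (_ : shear_z s t = fun q : space =>
    (q.1, q.2 + (s * q.1.1 + t * q.1.2))); last first.
  by apply/funext=> -[[x y] z].
have := @measure_preserving_fibre _ _ _ _ R
  (@lebesgue_measure R \x @lebesgue_measure R)%E (@lebesgue_measure R)
  (fun (p : R * R) z => z + (s * p.1 + t * p.2)).
apply.
  apply: measurable_fun_pair => //; exact: measurable_shift.
by move=> p; exact: measure_preserving_translation.
Qed.

Lemma measure_preserving_shear_y s t :
  measure_preserving lebesgue3 (shear_y s t).
Proof.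
have := @measure_preserving_cofibre _ _ _ _ R
  (@plane_measure R) (@lebesgue_measure R)
  (fun z (p : R * R) => (p.1, p.2 + (s * p.1 + t * z))).
apply.
  apply: measurable_fun_pair => //=; apply: measurable_fun_pair => //=.
  exact: measurable_shift.
move=> z.
have := @measure_preserving_fibre _ _ _ _ R
  (@lebesgue_measure R) (@lebesgue_measure R)
  (fun x y : R => y + (s * x + t * z)).
apply.
  apply: measurable_fun_pair => //=; apply: measurable_funD => //.
  by apply: measurable_funD => //; apply: measurable_funM.
by move=> x; exact: measure_preserving_translation.
Qed.

Lemma measure_preserving_shear_x s t :
  measure_preserving lebesgue3 (shear_x s t).
Proof.
have := @measure_preserving_cofibre _ _ _ _ R
  (@plane_measure R) (@lebesgue_measure R)
  (fun z (p : R * R) => (p.1 + (s * p.2 + t * z), p.2)).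
apply.
  apply: measurable_fun_pair => //=; apply: measurable_fun_pair => //=.
  exact: measurable_shift.
move=> z.
have := @measure_preserving_cofibre _ _ _ _ R
  (@lebesgue_measure R) (@lebesgue_measure R)
  (fun y x : R => x + (s * y + t * z)).
apply.
  apply: measurable_fun_pair => //=; apply: measurable_funD => //.
  by apply: measurable_funD => //; apply: measurable_funM.
by move=> x; exact: measure_preserving_translation.
Qed.

(** The affine map sending the coordinates [q] to the point with these
    coordinates in the frame of origin [p] and axes [u], [v], [w]. *)
Definition comb (p u v w q : space) : space :=
  (p.1.1 + (q.1.1 * u.1.1 + q.1.2 * v.1.1 + q.2 * w.1.1),
   p.1.2 + (q.1.1 * u.1.2 + q.1.2 * v.1.2 + q.2 * w.1.2),
   p.2 + (q.1.1 * u.2 + q.1.2 * v.2 + q.2 * w.2)).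

Definition triple (u v w : space) : R :=
  u.1.1 * (v.1.2 * w.2 - v.2 * w.1.2) - u.1.2 * (v.1.1 * w.2 - v.2 * w.1.1)
  + u.2 * (v.1.1 * w.1.2 - v.1.2 * w.1.1).

(** Some measure-preserving injection straightens all the bodies spanned by
    [u], [v], [w] at [p] into bodies aligned with the axes.  The product
    condition records that the determinant survives. *)
Definition diagonalizable (p u v w : space) :=
  exists f : space -> space, exists p' : space, exists a b c : R,
  [/\ measure_preserving lebesgue3 f, injective f, a * b * c = triple u v w &
      forall q, f (comb p u v w q) = comb p' (a, 0, 0) (0, b, 0) (0, 0, c) q].

Let eqP3 (a b c a' b' c' : R) :
  a = a' -> b = b' -> c = c' -> (a, b, c) = (a', b', c').
Proof. by move=> -> -> ->. Qed.

Let diagonalizable_step (E : space -> space) p u v w :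
  measure_preserving lebesgue3 E -> injective E ->
  triple (E u) (E v) (E w) = triple u v w ->
  (forall q, E (comb p u v w q) = comb (E p) (E u) (E v) (E w) q) ->
  diagonalizable (E p) (E u) (E v) (E w) -> diagonalizable p u v w.
Proof.
move=> mE iE dE cE [f [p' [a [b [c [mf fi abc fE]]]]]].
exists (f \o E), p', a, b, c; split.
- exact: measure_preserving_comp.
- exact: inj_comp.
- by rewrite abc.
- by move=> q /=; rewrite cE fE.
Qed.

Let diagonalizable_shear_x s t p u v w :
  let E := shear_x s t in
  diagonalizable (E p) (E u) (E v) (E w) -> diagonalizable p u v w.
Proof.
apply: diagonalizable_step.
- exact: measure_preserving_shear_x.
- move=> [[x y] z] [[x' y'] z']; rewrite /shear_x/= => -[xE yE zE].
  by subst y' z'; have -> : x = x' by lra.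
- by rewrite /triple/shear_x/=; ring.
- by move=> q; rewrite /comb/shear_x/=; apply: eqP3; ring.
Qed.

Let diagonalizable_shear_y s t p u v w :
  let E := shear_y s t in
  diagonalizable (E p) (E u) (E v) (E w) -> diagonalizable p u v w.
Proof.
apply: diagonalizable_step.
- exact: measure_preserving_shear_y.
- move=> [[x y] z] [[x' y'] z']; rewrite /shear_y/= => -[xE yE zE].
  by subst x' z'; have -> : y = y' by lra.
- by rewrite /triple/shear_y/=; ring.
- by move=> q; rewrite /comb/shear_y/=; apply: eqP3; ring.
Qed.

Let diagonalizable_shear_z s t p u v w :
  let E := shear_z s t in
  diagonalizable (E p) (E u) (E v) (E w) -> diagonalizable p u v w.
Proof.
apply: diagonalizable_step.
- exact: measure_preserving_shear_z.
- move=> [[x y] z] [[x' y'] z']; rewrite /shear_z/= => -[xE yE zE].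
  by subst x' y'; have -> : z = z' by lra.
- by rewrite /triple/shear_z/=; ring.
- by move=> q; rewrite /comb/shear_z/=; apply: eqP3; ring.
Qed.

Ltac solve_coords :=
  apply: eqP3; rewrite ?(mul0r, mulr0, addr0, add0r) //; field;
  do ?(apply/andP; split).

Let diagonalizable_diag p a b c :
  diagonalizable p (a, 0, 0) (0, b, 0) (0, 0, c).
Proof.
by exists id, p, a, b, c; split => //; rewrite /triple/=; ring.
Qed.

Let diagonalizable_triangular p (a b c e f i : R) : e != 0 -> i != 0 ->
  diagonalizable p (a, 0, 0) (b, e, 0) (c, f, i).
Proof.
move=> e0 i0; apply: (@diagonalizable_shear_y 0 (- (f / i))).
apply: (@diagonalizable_shear_x (- (b / e)) (- (c / i))).
rewrite /shear_y/shear_x/=.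
rewrite (_ : (a + _, _, _) = (a, 0, 0)); last by solve_coords.
rewrite (_ : (b + _, _, _) = (0, e, 0)); last by solve_coords.
rewrite (_ : (c + _, _, _) = (0, 0, i)); last by solve_coords.
exact: diagonalizable_diag.
Qed.

Let diagonalizable_block p (a b c e f h i : R) : e * i - h * f != 0 ->
  diagonalizable p (a, 0, 0) (b, e, h) (c, f, i).
Proof.
wlog e0 : p e f / e != 0 => [H|] D.
  have [e0|e0] := eqVneq e 0; last by apply: H.
  apply: (@diagonalizable_shear_y 0 1); rewrite /shear_y/=.
  rewrite (_ : (a, _, _) = (a, 0, 0)); last by solve_coords.
  apply: H.
    move: D; rewrite e0; apply: contra => /eqP H.
    have -> : h = 0 by move: H; lra.
    by rewrite !mul0r subr0.
  by apply: contra D => /eqP <-; apply/eqP; ring.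
apply: (@diagonalizable_shear_z 0 (- (h / e))); rewrite /shear_z/=.
rewrite (_ : (a, _, _) = (a, 0, 0)); last by solve_coords.
rewrite (_ : (b, _, _) = (b, e, 0)); last by solve_coords.
apply: diagonalizable_triangular => //.
apply: contra D => /eqP H; apply/eqP.
transitivity (e * (i + (0 * c + - (h / e) * f))); first by field.
by rewrite H mulr0.
Qed.

(** Gaussian elimination that adds coordinates to one another and never swaps
    or rescales them, so that the determinant is exactly kept: a zero pivot is
    repaired by adding to it a nonzero entry of the same column. *)
Lemma triple_neq0_diagonalizable (p u v w : space) :
  triple u v w != 0 -> diagonalizable p u v w.
Proof.
move: u v w => [[a d] g] [[b e] h] [[c f] i].
wlog a0 : p a b c / a != 0 => [H|] D.
  have [a0|a0] := eqVneq a 0; last by apply: H.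
  have [d0|d0] := eqVneq d 0.
    have g0 : g != 0.
      apply: contra D => /eqP g0; apply/eqP.
      by rewrite /triple/= a0 d0 g0; ring.
    apply: (@diagonalizable_shear_x 0 1); apply: H.
      by rewrite /= a0 mul0r !add0r mul1r.
    by apply: contra D => /eqP <-; apply/eqP; rewrite /triple/=; ring.
  apply: (@diagonalizable_shear_x 1 0); apply: H.
    by rewrite /= a0 mul0r addr0 add0r mul1r.
  by apply: contra D => /eqP <-; apply/eqP; rewrite /triple/=; ring.
apply: (@diagonalizable_shear_y (- (d / a)) 0).
apply: (@diagonalizable_shear_z (- (g / a)) 0); rewrite /shear_y/shear_z/=.
rewrite (_ : (a, _, _) = (a, 0, 0)); last by solve_coords.
apply: diagonalizable_block.
apply: contra D => /eqP H; apply/eqP; rewrite /triple/=.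
set X := (X in X = 0) in H.
transitivity (a * X); first by rewrite /X; field.
by rewrite H mulr0.
Qed.

Let cube (k : R) : set space :=
  [set q | [/\ 0 <= q.1.1 <= k, 0 <= q.1.2 <= k & 0 <= q.2 <= k]].

Definition simplex : set space :=
  [set q | [/\ 0 <= q.1.1, 0 <= q.1.2, 0 <= q.2 & q.1.1 + q.1.2 + q.2 <= 1]].

Let segment_measure (p a k : R) : a != 0 -> 0 < k ->
  let S := [set x | exists2 t, 0 <= t <= k & x = p + t * a] in
  measurable S /\ lebesgue_measure S = (k * `|a|)%:E.
Proof.
move=> a0 k0 S; have [an|ap|/eqP] := ltrgtP a 0; last by rewrite (negbTE a0).
  have SE : S = `[p + k * a, p]%classic.
    apply/seteqP; split=> x /=; rewrite in_itv/=.
      by move=> [t /andP[t0 tk] ->]; apply/andP; split; nra.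
    move=> /andP[x1 x2]; exists ((x - p) / a); last by field.
    apply/andP; split; first by rewrite ler_ndivlMr// mul0r subr_le0.
    by rewrite ler_ndivrMr//; lra.
  rewrite SE; split; first exact: measurable_itv.
  have ka : p + k * a < p by nra.
  rewrite lebesgue_measure_itv/= lte_fin ka ltr0_norm//.
  by rewrite -EFinB; congr (_%:E); ring.
have SE : S = `[p, p + k * a]%classic.
  apply/seteqP; split=> x /=; rewrite in_itv/=.
    by move=> [t /andP[t0 tk] ->]; apply/andP; split; nra.
  move=> /andP[x1 x2]; exists ((x - p) / a); last by field.
  apply/andP; split; first by rewrite ler_pdivlMr// mul0r subr_ge0.
  by rewrite ler_pdivrMr//; lra.
rewrite SE; split; first exact: measurable_itv.
have ka : p < p + k * a by nra.
rewrite lebesgue_measure_itv/= lte_fin ka gtr0_norm//.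
by rewrite -EFinB; congr (_%:E); ring.
Qed.

Let diag_cube p a b c k : a != 0 -> b != 0 -> c != 0 -> 0 < k ->
  let B := comb p (a, 0, 0) (0, b, 0) (0, 0, c) @` cube k in
  measurable B /\ lebesgue3 B = (k ^+ 3 * `|a * b * c|)%:E.
Proof.
move=> a0 b0 c0 k0 B.
pose S (o s : R) := [set x : R | exists2 t, 0 <= t <= k & x = o + t * s].
pose SA := S p.1.1 a; pose SB := S p.1.2 b; pose SC := S p.2 c.
have [mA lA] : measurable SA /\ lebesgue_measure SA = (k * `|a|)%:E.
  exact: segment_measure.
have [mB lB] : measurable SB /\ lebesgue_measure SB = (k * `|b|)%:E.
  exact: segment_measure.
have [mC lC] : measurable SC /\ lebesgue_measure SC = (k * `|c|)%:E.
  exact: segment_measure.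
have -> : B = SA `*` SB `*` SC.
  apply/seteqP; split=> [q [t [t1 t2 t3] <-]|[[x y] z]].
    rewrite /comb/=; split; [split|] => /=.
    - by exists t.1.1 => //; ring.
    - by exists t.1.2 => //; ring.
    - by exists t.2 => //; ring.
  move=> [[[t1 h1 /= xE] [t2 h2 /= yE]] [t3 h3 /= zE]].
  exists (t1, t2, t3) => //; rewrite /comb/= xE yE zE.
  by apply: eqP3; ring.
have mAB : measurable (SA `*` SB) by exact: measurableX.
split; first exact: measurableX.
rewrite product_measure1E//.
rewrite [X in (X * _)%E]product_measure1E//.
by rewrite /= lA lB lC -!EFinM !normrM; congr (_%:E); ring.
Qed.

Let diag_simplex p a b c : a != 0 -> b != 0 -> c != 0 ->
  measurable (comb p (a, 0, 0) (0, b, 0) (0, 0, c) @` simplex).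
Proof.
move=> a0 b0 c0.
pose x (q : space) := (q.1.1 - p.1.1) / a.
pose y (q : space) := (q.1.2 - p.1.2) / b.
pose z (q : space) := (q.2 - p.2) / c.
have mx : measurable_fun setT x.
  by apply: measurable_funM => //; apply: measurable_funB.
have my : measurable_fun setT y.
  by apply: measurable_funM => //; apply: measurable_funB.
have mz : measurable_fun setT z.
  by apply: measurable_funM => //; apply: measurable_funB.
have nonneg (f : space -> R) : measurable_fun setT f ->
    measurable [set q | 0 <= f q].
  move=> mf; rewrite -[X in measurable X]setTI.
  rewrite (_ : [set q | _] = f @^-1` `[0, +oo[%classic); last first.
    by apply/seteqP; split=> q /=; rewrite in_itv/= andbT.
  exact: mf.
rewrite (_ : _ @` _ = [set q | 0 <= x q] `&` [set q | 0 <= y q] `&`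
   [set q | 0 <= z q] `&` [set q | 0 <= 1 - (x q + y q + z q)]).
  apply: measurableI; last first.
    apply: nonneg; apply: measurable_funB => //.
    by do 2 apply: measurable_funD => //.
  by apply: measurableI; [apply: measurableI|]; exact: nonneg.
apply/seteqP; split=> [q [[[t1 t2] t3] [/= h1 h2 h3 h4] <-]|q].
  rewrite /x /y /z /comb/=.
  have -> : (p.1.1 + (t1 * a + t2 * 0 + t3 * 0) - p.1.1) / a = t1 by field.
  have -> : (p.1.2 + (t1 * 0 + t2 * b + t3 * 0) - p.1.2) / b = t2 by field.
  have -> : (p.2 + (t1 * 0 + t2 * 0 + t3 * c) - p.2) / c = t3 by field.
  by rewrite subr_ge0; do !split.
move=> [[[/= h1 h2] h3]]; rewrite subr_ge0 => h4.
exists (x q, y q, z q); first by split.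
rewrite /comb/=; move: q {h1 h2 h3 h4} => [[q1 q2] q3].
by rewrite /x /y /z/=; solve_coords.
Qed.

(** Enclosing the simplex between the cubes of sides 1/3 and 1 of its frame
    spares the exact value 1/6; 27 is the cube of 3. *)
Lemma simplex_volume (p u v w : space) : triple u v w != 0 ->
  ((`|triple u v w| / 27)%:E <= lebesgue3 (comb p u v w @` simplex)
     <= `|triple u v w|%:E)%E.
Proof.
move=> D; set S := comb p u v w @` simplex.
have [f [p' [a [b [c [[mf fE] fi abc fC]]]]]] := triple_neq0_diagonalizable p D.
have [a0 b0 c0] : [/\ a != 0, b != 0 & c != 0].
  by move: D; rewrite -abc !mulf_eq0 !negb_or => /andP[/andP[]].
have imE K : comb p u v w @` K =
    f @^-1` (comb p' (a, 0, 0) (0, b, 0) (0, 0, c) @` K).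
  apply/seteqP; split=> [q [t Kt <-]|q [t Kt tE]] /=.
    by exists t => //; rewrite fC.
  by exists t => //; apply: fi; rewrite fC.
have mim K : measurable (comb p' (a, 0, 0) (0, b, 0) (0, 0, c) @` K) ->
    measurable (comb p u v w @` K).
  by move=> mK; rewrite imE -[_ @^-1` _]setTI; exact: mf.
have mS : measurable S by apply: mim; exact: diag_simplex.
have cubeE k : 0 < k -> measurable (comb p u v w @` cube k) /\
    lebesgue3 (comb p u v w @` cube k) = (k ^+ 3 * `|triple u v w|)%:E.
  move=> k0; have [mB lB] := diag_cube p' a0 b0 c0 k0.
  split; first exact: mim.
  by rewrite imE fE// lB abc.
apply/andP; split.
  have [mB lB] := cubeE (3^-1) ltac:(by rewrite invr_gt0).
  have -> : `|triple u v w| / 27 = (3^-1) ^+ 3 * `|triple u v w| by field.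
  rewrite -lB; apply: le_measure; rewrite ?inE//.
  apply: image_subset => -[[q1 q2] q3] [/= q1H q2H q3H].
  by split=> /=; lra.
have [mB lB] := cubeE 1 ltr01.
have -> : `|triple u v w| = 1 ^+ 3 * `|triple u v w| by rewrite expr1n mul1r.
rewrite -lB; apply: le_measure; rewrite ?inE//.
apply: image_subset => -[[q1 q2] q3] [/= q1H q2H q3H q4H].
by split=> /=; lra.
Qed.

End Space.

(** * Euclidean vectors *)
Section Vectors.
Variable R : realType.
Implicit Types u v w e : 'rV[R]_3.

Definition coords u : R * R * R :=
  (u 0 ord0, u 0 (lift ord0 ord0), u 0 ord_max).

Definition cross u v : 'rV[R]_3 :=
  let a := coords u in let b := coords v in
  of_coords (a.1.2 * b.2 - a.2 * b.1.2, a.2 * b.1.1 - a.1.1 * b.2,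
             a.1.1 * b.1.2 - a.1.2 * b.1.1).

Definition mixed u v w : R := triple (coords u) (coords v) (coords w).

Lemma of_coordsK : cancel (@of_coords R) coords.
Proof. by move=> [[x y] z]; rewrite /coords/of_coords !mxE/=. Qed.

Lemma coordsK : cancel coords (@of_coords R).
Proof.
move=> u; apply/rowP => i; rewrite mxE /=.
by case: i => [[|[|[|//]]] ?] /=; congr (u _ _); exact: val_inj.
Qed.

Lemma dotE u v : dot u v =
  (coords u).1.1 * (coords v).1.1 + (coords u).1.2 * (coords v).1.2
  + (coords u).2 * (coords v).2.
Proof.
rewrite /dot !big_ord_recr big_ord0 /= add0r.
by congr (_ * _ + _ * _ + _ * _); congr (_ _ _); exact: val_inj.
Qed.

Lemma coordsD u v : coords (u + v) =
  ((coords u).1.1 + (coords v).1.1, (coords u).1.2 + (coords v).1.2,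
   (coords u).2 + (coords v).2).
Proof. by rewrite /coords !mxE. Qed.

Lemma coordsN u : coords (- u) =
  (- (coords u).1.1, - (coords u).1.2, - (coords u).2).
Proof. by rewrite /coords !mxE. Qed.

Lemma coordsZ a u : coords (a *: u) =
  (a * (coords u).1.1, a * (coords u).1.2, a * (coords u).2).
Proof. by rewrite /coords !mxE. Qed.

(** Reduces an identity between dot products to one between polynomials in
    the coordinates, which [ring] decides. *)
Definition vecE :=
  (dotE, of_coordsK, coordsD, coordsN, coordsZ).

Lemma dotC u v : dot u v = dot v u.
Proof. by rewrite !dotE; ring. Qed.

Lemma dot_ge0 u : 0 <= dot u u.
Proof. by rewrite dotE -!expr2 !addr_ge0 ?sqr_ge0. Qed.

Lemma enorm_ge0 u : 0 <= enorm u. Proof. exact: sqrtr_ge0. Qed.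

Lemma enorm_sqr u : enorm u ^+ 2 = dot u u.
Proof. by rewrite sqr_sqrtr// dot_ge0. Qed.

Lemma dot_cross u v :
  dot (cross u v) (cross u v) = dot u u * dot v v - dot u v ^+ 2.
Proof. by rewrite /cross !vecE/=; ring. Qed.

Lemma cauchy_schwarz u v : `|dot u v| <= enorm u * enorm v.
Proof.
rewrite -[leRHS]ger0_norm ?mulr_ge0 ?enorm_ge0//.
rewrite -ler_sqr ?nnegrE// !real_normK ?num_real// exprMn !enorm_sqr.
by rewrite -subr_ge0 -dot_cross dot_ge0.
Qed.

Lemma enormD u v : enorm (u + v) <= enorm u + enorm v.
Proof.
rewrite -ler_sqr ?nnegrE ?addr_ge0 ?enorm_ge0// sqrrD !enorm_sqr.
have -> : dot (u + v) (u + v) = dot u u + dot u v *+ 2 + dot v v.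
  by rewrite !vecE/=; ring.
have := cauchy_schwarz u v; have := ler_norm (dot u v); lra.
Qed.

Lemma dot_diff u v : dot (u - v) (u - v) = dot u u + dot v v - 2 * dot u v.
Proof. by rewrite !vecE/=; ring. Qed.

Lemma enormZ a u : enorm (a *: u) = `|a| * enorm u.
Proof.
rewrite /enorm -sqrtr_sqr -sqrtrM ?sqr_ge0//; congr (Num.sqrt _).
by rewrite !vecE/=; ring.
Qed.

Lemma distC x y : dist x y = dist y x :> R.
Proof. by rewrite /dist /enorm !vecE/=; congr (Num.sqrt _); ring. Qed.

Lemma dist_triangle x y z : dist x z <= dist x y + dist y z :> R.
Proof.
rewrite /dist (_ : x - z = (x - y) + (y - z)); first exact: enormD.
by rewrite addrA subrK.
Qed.

Lemma enorm_crossC u v : enorm (cross u v) = enorm (cross v u).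
Proof. by rewrite /enorm; congr Num.sqrt; rewrite /cross !vecE/=; ring. Qed.

Lemma mixedE u v w : mixed u v w = dot (cross u v) w.
Proof. by rewrite /mixed /triple /cross !vecE/=; ring. Qed.

Lemma mixed_sqr_le u v w :
  mixed u v w ^+ 2 <= (dot u u * dot v v - dot u v ^+ 2) * dot w w.
Proof.
rewrite mixedE -dot_cross -subr_ge0 -dot_cross; exact: dot_ge0.
Qed.

(** The mixed product against sines of dihedral angles: the cross products
    with [e] are normal to the faces meeting along [e]. *)
Lemma mixed_sqr_cross e u v :
  mixed e u v ^+ 2 * dot e e = dot (cross e u) (cross e u)
    * dot (cross e v) (cross e v) - dot (cross e u) (cross e v) ^+ 2.
Proof. by rewrite /mixed/triple/cross !vecE/=; ring. Qed.

Lemma dot_eq0 u : (dot u u == 0) = (u == 0).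
Proof.
apply/idP/eqP => [|->]; last by rewrite dotE /coords !mxE/= !mul0r !addr0.
rewrite dotE -!expr2 !paddr_eq0 ?addr_ge0 ?sqr_ge0// !sqrf_eq0.
move=> /andP[/andP[/eqP x0 /eqP y0] /eqP z0].
rewrite -[u]coordsK; move: x0 y0 z0; case: (coords u) => [[x y] z]/= -> -> ->.
by apply/rowP => -[[|[|[|//]]] ?]; rewrite !mxE.
Qed.

(** The dihedral angle along [e], defined with orthogonal parts, is the angle
    between the normals of the two faces: rotation by a quarter turn
    around [e], followed by multiplication by its length, sends one pair of
    vectors to the other. *)
Lemma dot_orth_part e u v : e != 0 ->
  dot (orth_part e u) (orth_part e v) * dot e e
    = dot (cross e u) (cross e v).
Proof.
rewrite -dot_eq0 => e0.
have -> : dot (cross e u) (cross e v) = dot e e * dot u v - dot u e * dot v e.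
  by rewrite /cross !vecE/=; ring.
have expand a b : dot (u - a *: e) (v - b *: e) =
    dot u v - b * dot u e - a * dot v e + a * b * dot e e.
  by rewrite !vecE/=; ring.
by rewrite /orth_part expand; field.
Qed.

End Vectors.

(** * Volume, diameter and edges of a tetrahedron *)

Section Tetrahedra.
Variable R : realType.
Implicit Types T : tetrahedron R.

Let sum4 (V : nmodType) (F : 'I_4 -> V) : \sum_(i < 4) F i =
  F (inord 0) + F (inord 1) + F (inord 2) + F (inord 3).
Proof.
rewrite !big_ord_recr big_ord0/= add0r.
by congr (_ + _ + _ + _); congr F; apply: val_inj; rewrite /= inordK.
Qed.

Let all4 (P : 'I_4 -> Prop) :
  P (inord 0) -> P (inord 1) -> P (inord 2) -> P (inord 3) -> forall i, P i.
Proof.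
move=> P0 P1 P2 P3 i; rewrite -[i]inord_val.
by case: i => [[|[|[|[|//]]]] ?].
Qed.

Definition mixed_at T (i j k l : 'I_4) : R :=
  mixed (vertex T j - vertex T i) (vertex T k - vertex T i)
    (vertex T l - vertex T i).

(** Any vertex could be used instead of the first one, in any order:
    see [mixed_at_span_volume]. *)
Definition span_volume T : R :=
  `|mixed_at T (inord 0) (inord 1) (inord 2) (inord 3)|.

(** Transposing two neighbours in the list of vertices changes the sign of the
    mixed product. *)
Let mixed_swap (a b c d : 'rV[R]_3) :
  [/\ `|mixed (a - b) (c - b) (d - b)| = `|mixed (b - a) (c - a) (d - a)|,
      `|mixed (c - a) (b - a) (d - a)| = `|mixed (b - a) (c - a) (d - a)| &
      `|mixed (b - a) (d - a) (c - a)| = `|mixed (b - a) (c - a) (d - a)|].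
Proof.
split; rewrite -[RHS]normrN; congr `|_|; rewrite /mixed !vecE;
  move: (coords a) (coords b) (coords c) (coords d)
    => [[x0 y0] z0] [[x1 y1] z1] [[x2 y2] z2] [[x3 y3] z3];
  by rewrite /triple/=; ring.
Qed.

Lemma mixed_at_span_volume T i j k l : uniq [:: i; j; k; l] ->
  `|mixed_at T i j k l| = span_volume T.
Proof.
have swap a b c d :=
  mixed_swap (vertex T a) (vertex T b) (vertex T c) (vertex T d).
pose G a b c d := `|mixed_at T (inord a) (inord b) (inord c) (inord d)|.
have swap12 a b c d : G b a c d = G a b c d.
  by case: (swap (inord a) (inord b) (inord c) (inord d)).
have swap23 a b c d : G a c b d = G a b c d.
  by case: (swap (inord a) (inord b) (inord c) (inord d)).
have swap34 a b c d : G a b d c = G a b c d.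
  by case: (swap (inord a) (inord b) (inord c) (inord d)).
move=> U.
have -> : `|mixed_at T i j k l| = G i j k l by rewrite /G !inord_val.
have -> : span_volume T = G 0%N 1%N 2%N 3%N by [].
move: U; case: i => [[|[|[|[|//]]]] ?]; case: j => [[|[|[|[|//]]]] ?] //;
case: k => [[|[|[|[|//]]]] ?] //; case: l => [[|[|[|[|//]]]] ?] // _ /=;
(* bubble sort of the four indices *)
repeat match goal with |- G ?a ?b ?c ?d = _ =>
  first
  [ match eval compute in (b < a)%N with true => rewrite (swap12 b a c d) end
  | match eval compute in (c < b)%N with true => rewrite (swap23 a c b d) end
  | match eval compute in (d < c)%N with true => rewrite (swap34 a b d c) end ]
end; reflexivity.
Qed.

Let det3 (A : 'M[R]_3) (a := fun i j => A (inord i) (inord j)) :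
  \det A = a 0%N 0%N * (a 1%N 1%N * a 2%N 2%N - a 1%N 2%N * a 2%N 1%N)
    - a 0%N 1%N * (a 1%N 0%N * a 2%N 2%N - a 1%N 2%N * a 2%N 0%N)
    + a 0%N 2%N * (a 1%N 0%N * a 2%N 1%N - a 1%N 1%N * a 2%N 0%N).
Proof.
have aE (i j : 'I_3) : A i j = a i j by rewrite /a !inord_val.
rewrite (expand_det_row _ ord0) !big_ord_recr big_ord0 /= add0r /cofactor.
rewrite !(expand_det_row _ ord0) !big_ord_recr !big_ord0 /= !add0r /cofactor.
by rewrite !det_mx11 !mxE !aE /= /bump /=; ring.
Qed.

Lemma span_volume_gt0 T : 0 < span_volume T.
Proof.
rewrite /span_volume normr_gt0; have := vertex_free T.
rewrite row_free_unit unitmxE unitfE det3 !mxE.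
have lift_inord n : (n < 3)%N ->
    lift ord0 (inord n : 'I_3) = inord n.+1 :> 'I_4.
  by move=> n3; apply: val_inj; rewrite /= !inordK.
rewrite !lift_inord// (_ : ord0 = inord 0); last first.
  by apply: val_inj; rewrite /= inordK.
have c1 : ord0 = inord 0 :> 'I_3 by apply: val_inj; rewrite /= inordK.
have c2 : lift ord0 ord0 = inord 1 :> 'I_3 by apply: val_inj; rewrite /= inordK.
have c3 : ord_max = inord 2 :> 'I_3 by apply: val_inj; rewrite /= inordK.
apply: contra => /eqP <-; apply/eqP.
by rewrite /mixed_at /mixed /triple /coords /= !mxE -c1 -c2 -c3; ring.
Qed.

Lemma mixed_at_sqr T i j k l : uniq [:: i; j; k; l] ->
  mixed_at T i j k l ^+ 2 = span_volume T ^+ 2.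
Proof.
by move=> U; rewrite -(mixed_at_span_volume T U) real_normK ?num_real.
Qed.

Lemma edge_neq0 T i j k l : uniq [:: i; j; k; l] ->
  vertex T j - vertex T i != 0.
Proof.
move=> U; apply/eqP => e0; have := span_volume_gt0 T.
rewrite -(mixed_at_span_volume T U) /mixed_at e0 -[X in mixed X](scale0r 0).
by rewrite /mixed coordsZ /triple /= !mul0r subrr addr0 normr0 ltxx.
Qed.

Lemma cross_edges_neq0 T i j k l : uniq [:: i; j; k; l] ->
  cross (vertex T j - vertex T i) (vertex T k - vertex T i) != 0.
Proof.
move=> U; apply/eqP => e0; have := span_volume_gt0 T.
rewrite -(mixed_at_span_volume T U) /mixed_at mixedE e0.
rewrite -[X in dot X](scale0r 0).
by rewrite dotE coordsZ /= !mul0r !addr0 normr0 ltxx.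
Qed.

(** Barycentric coordinates, without the one of the first vertex, are
    coordinates in the frame of the edges at that vertex. *)
Lemma tetra_set_coords T (q := fun n => vertex T (inord n)) :
  @of_coords R @^-1` tetra_set T =
  comb (coords (q 0%N)) (coords (q 1%N - q 0%N)) (coords (q 2%N - q 0%N))
    (coords (q 3%N - q 0%N)) @` @simplex R.
Proof.
apply/seteqP; split=> [x [w [w0]]|x [[[r s] t] /= [r0 s0 t0 rst1] <-]].
  rewrite !sum4 -!/(q _) => w1 xE.
  exists (w (inord 1), w (inord 2), w (inord 3)).
    by split; rewrite /= ?w0//; have := w0 (inord 0); move: w1; lra.
  rewrite -[x]of_coordsK xE !vecE /comb/=.
  have -> : w (inord 0) = 1 - w (inord 1) - w (inord 2) - w (inord 3).
    by move: w1; lra.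
  by congr (_, _, _); ring.
exists (fun i => [:: 1 - r - s - t; r; s; t]`_i); split.
- move: r0 s0 t0 rst1 => /= r0 s0 t0 rst1.
  by apply: all4; rewrite inordK//=; lra.
- by rewrite sum4 !inordK//=; ring.
rewrite sum4 !inordK//= -!/(q _); apply: (can_inj (@coordsK R)).
rewrite of_coordsK !vecE /comb/=.
by congr (_, _, _); ring.
Qed.

Lemma volume_bounds T :
  span_volume T / 27 <= volume (tetra_set T) <= span_volume T.
Proof.
have fine_itv (a b : R) x : (a%:E <= x <= b%:E)%E -> a <= fine x <= b.
  by case: x => [v||]; rewrite ?lee_fin ?leye_eq ?leeNy_eq ?andbF.
rewrite /volume tetra_set_coords; apply: fine_itv; apply: simplex_volume.
by rewrite -normr_gt0; exact: span_volume_gt0.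
Qed.

(** A ball is convex. *)
Let tetra_set_dist T (i : 'I_4) (m : R) :
  (forall j, dist (vertex T j) (vertex T i) <= m) ->
  forall x, tetra_set T x -> dist x (vertex T i) <= m.
Proof.
move=> hm x [w [w0 w1 ->]]; rewrite /dist.
have -> : \sum_j w j *: vertex T j - vertex T i =
    \sum_j w j *: (vertex T j - vertex T i).
  rewrite -[X in _ - X]scale1r -w1 scaler_suml -sumrB.
  by apply: eq_bigr => j _; rewrite scalerBr.
have -> : m = \sum_j w j * m by rewrite -mulr_suml w1 mul1r.
have le j : enorm (w j *: (vertex T j - vertex T i)) <= w j * m.
  by rewrite enormZ ger0_norm ?w0// ler_wpM2l ?w0//; exact: hm.
rewrite !sum4.
do 3 (apply: le_trans (enormD _ _) _; apply: lerD => //).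
Qed.

Let vertex_tetra_set T i : tetra_set T (vertex T i).
Proof.
exists (fun j => (j == i)%:R); split.
- by move=> j; exact: ler0n.
- by rewrite (bigD1 i)//= eqxx big1 ?addr0// => j /negbTE ->.
- rewrite (bigD1 i)//= eqxx scale1r big1 ?addr0// => j /negbTE ->.
  by rewrite scale0r.
Qed.

Let distances T := [set dist x y | x in tetra_set T & y in tetra_set T].

Let distances_ub T (i : 'I_4) (m : R) :
  (forall j, dist (vertex T j) (vertex T i) <= m) ->
  ubound (distances T) (2 * m).
Proof.
move=> hm _ [x Tx [y Ty <-]].
apply: le_trans (dist_triangle _ (vertex T i) _) _.
rewrite [in X in _ + X]distC mulr_natl mulr2n.
by rewrite lerD// (tetra_set_dist hm).
Qed.

Lemma hT_ub T (i : 'I_4) (m : R) :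
  (forall j, dist (vertex T j) (vertex T i) <= m) -> hT T <= 2 * m.
Proof.
move=> hm; apply: ge_sup; last exact: distances_ub hm.
exists (dist (vertex T i) (vertex T i)), (vertex T i) => //.
by exists (vertex T i).
Qed.

Lemma dist_le_hT T i j : dist (vertex T i) (vertex T j) <= hT T.
Proof.
apply: ub_le_sup; last by exists (vertex T i) => //; exists (vertex T j).
exists (2 * \sum_k dist (vertex T k) (vertex T i)).
apply: (@distances_ub T i) => k.
by rewrite (bigD1 k)//= lerDl sumr_ge0// => k' _; exact: enorm_ge0.
Qed.

Let pair_perm (i j k l : 'I_4) : uniq [:: i; j; k; l] ->
  perm_eq (enum [pred e : 'I_4 * 'I_4 | (e.1 < e.2)%N])
    [seq (if (e.1 < e.2)%N then e else (e.2, e.1)) |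
      e : 'I_4 * 'I_4 <- [:: (i, j); (i, k); (j, k); (i, l); (j, l); (k, l)]].
Proof.
move=> U; apply: uniq_perm; first exact: enum_uniq.
  by move: U; case: i => [[|[|[|[|//]]]] ?]; case: j => [[|[|[|[|//]]]] ?] //;
    case: k => [[|[|[|[|//]]]] ?] //; case: l => [[|[|[|[|//]]]] ?].
move=> [a b]; rewrite mem_enum inE /=.
move: U; case: i => [[|[|[|[|//]]]] ?]; case: j => [[|[|[|[|//]]]] ?] //;
    case: k => [[|[|[|[|//]]]] ?] //; case: l => [[|[|[|[|//]]]] ?] // _;
 by case: a => [[|[|[|[|//]]]] ?]; case: b => [[|[|[|[|//]]]] ?].
Qed.

(** The six edges may be listed from any ordering of the vertices, which lets
    each later argument use the ordering that its angle suggests. *)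
Lemma edge_lengthsE T (i j k l : 'I_4) (q := vertex T) :
  uniq [:: i; j; k; l] ->
  edge_lengths T = sort <=%R [:: dist (q i) (q j); dist (q i) (q k);
    dist (q j) (q k); dist (q i) (q l); dist (q j) (q l); dist (q k) (q l)].
Proof.
move=> U; apply/perm_sortP; [exact: le_total|exact: le_trans|exact: le_anti|].
rewrite (perm_trans (perm_map _ (pair_perm U)))// -map_comp.
rewrite (_ : [:: dist _ _; _; _; _; _; _] =
   map (fun e : 'I_4 * 'I_4 => dist (q e.1) (q e.2))
   [:: (i, j); (i, k); (j, k); (i, l); (j, l); (k, l)])//.
rewrite (eq_map (g := fun e => dist (q e.1) (q e.2)))// => -[a b] /=.
by case: ifP => //= _; rewrite distC.
Qed.

End Tetrahedra.

(** * The two smallest entries of a list *)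

Section TwoSmallest.
Variable R : realDomainType.
Implicit Types s : seq R.

Lemma sorted_two_smallest_le s m n : sorted <=%R s -> all (>= 0) s ->
  (m < size s)%N -> (n < size s)%N -> m != n -> s`_0 * s`_1 <= s`_m * s`_n.
Proof.
move=> ss s0; wlog mn : m n / (m < n)%N => [H|] ms ns.
  by rewrite neq_ltn => /orP[mn|mn]; [|rewrite [leRHS]mulrC];
     apply: H; rewrite ?ltn_eqF.
move=> _; have mono i j : (i <= j)%N -> (j < size s)%N -> s`_i <= s`_j.
  move=> ij js; apply: (sorted_leq_nth le_trans le_refl) => //.
  by rewrite inE (leq_ltn_trans ij).
have ge0 i : (i < size s)%N -> 0 <= s`_i by move=> /(all_nthP 0 s0).
have n0 : (0 < n)%N by exact: leq_ltn_trans mn.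
by apply: ler_pM; rewrite ?ge0 ?mono//; apply: leq_ltn_trans ns.
Qed.

Lemma sort_reindexing s :
  exists Is : seq nat, [/\ uniq Is, Is =i iota 0 (size s), size Is = size s &
    sort <=%R s = [seq s`_j | j <- Is]].
Proof.
have /(perm_iotaP 0)[Is pIs ->] : perm_eq (sort <=%R s) s by rewrite perm_sort.
exists Is; split=> //; first by rewrite (perm_uniq pIs) iota_uniq.
  exact: perm_mem.
by rewrite (perm_size pIs) size_iota.
Qed.

Lemma sort_two_smallest_le s m n : all (>= 0) s ->
  (m < size s)%N -> (n < size s)%N -> m != n ->
  (sort <=%R s)`_0 * (sort <=%R s)`_1 <= s`_m * s`_n.
Proof.
move=> s0 ms ns mn; have [Is [uI mI sI sE]] := sort_reindexing s.
have pos k : (k < size s)%N -> s`_k = (sort <=%R s)`_(index k Is).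
  move=> ks; have kI : k \in Is by rewrite mI mem_iota.
  by rewrite sE (nth_map 0%N) ?index_mem// nth_index.
have szI k : (k < size s)%N -> (index k Is < size (sort <=%R s))%N.
  by move=> ks; rewrite size_sort -sI index_mem mI mem_iota.
rewrite (pos _ ms) (pos _ ns); apply: sorted_two_smallest_le.
- exact/sort_sorted/le_total.
- by rewrite all_sort.
- exact: szI.
- exact: szI.
apply: contra mn => /eqP E; have := nth_index 0%N (_ : m \in Is).
rewrite E nth_index ?mI ?mem_iota//.
by move=> ->.
Qed.

Lemma sort_two_smallest_attained s : (1 < size s)%N ->
  exists m n, [/\ (m < n)%N, (n < size s)%N &
    (sort <=%R s)`_0 * (sort <=%R s)`_1 = s`_m * s`_n].
Proof.
move=> s1; have [Is [uI mI sI sE]] := sort_reindexing s.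
have s0 : (0 < size s)%N by exact: ltnW.
rewrite sE !(nth_map 0%N) ?sI//.
have I0 : (nth 0%N Is 0 < size s)%N.
  by have := mem_nth 0%N (_ : 0 < size Is)%N; rewrite sI mI mem_iota; exact.
have I1 : (nth 0%N Is 1 < size s)%N.
  by have := mem_nth 0%N (_ : 1 < size Is)%N; rewrite sI mI mem_iota; exact.
have : nth 0%N Is 0 != nth 0%N Is 1 by rewrite nth_uniq ?sI.
rewrite neq_ltn => /orP[lt|lt].
  by exists (nth 0%N Is 0), (nth 0%N Is 1).
by exists (nth 0%N Is 1), (nth 0%N Is 0); rewrite mulrC.
Qed.

End TwoSmallest.

(** * Inequalities between edge lengths *)

Section Numeric.
Variable R : realFieldType.
Implicit Types a b c m x y z H P e r s : R.

Let le_mul3 u v w P H : 0 <= u -> 0 <= v -> 0 <= w ->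
  u * v <= P -> w <= H -> u * v * w <= P * H.
Proof. by move=> *; apply: ler_pM; rewrite ?mulr_ge0. Qed.

Let le_mul2 u v P Q : 0 <= u -> 0 <= v -> u <= P -> v <= Q ->
  u * v <= 2 * (P * Q).
Proof.
move=> u0 v0 uP vQ; apply: le_trans (ler_pM u0 v0 uP vQ) _.
have : 0 <= P * Q by apply: mulr_ge0; lra.
lra.
Qed.

(** The case of two shortest edges [P] and [Q] that share a vertex: the third
    side [u] of their triangle need not be shortest, but it is at most their
    sum. *)
Let le_mul_sum u v P Q : 0 <= v -> v <= P -> v <= Q -> u <= P + Q ->
  u * v <= 2 * (P * Q).
Proof.
move=> v0 vP vQ uPQ.
have h1 : u * v <= (P + Q) * v by apply: ler_wpM2r.
have h2 : P * v <= P * Q by apply: ler_wpM2l => //; lra.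
have h3 : Q * v <= Q * P by apply: ler_wpM2l => //; lra.
lra.
Qed.

(** The face has sides [a], [b], [c], the angle being between [a] and [b]; the
    edges from the fourth vertex to the ends of [a] are [x] and [y], and [z]
    goes to the other vertex.  The indices [i] and [j] are the positions of the
    two shortest edges; for each of the fifteen pairs, some two factors on the
    left have a product at most twice that of the pair, and the third one is
    at most [H]. *)
Lemma obtuse_face_product a b c m x y z H (s := [:: a; b; c; x; y; z]) i j :
  (i < j < 6)%N -> all (fun t => 0 <= t <= H) s -> 0 <= m ->
  a <= c -> b <= c -> m <= x -> m <= y -> m <= z ->
  a <= x + y -> b <= x + z -> c <= y + z ->
  a * b * m <= 2 * (s`_i * s`_j) * H.
Proof.
move=> ij; rewrite /s /= andbT.
move=> /and5P[/andP[a0 aH] /andP[b0 bH] /andP[c0 cH] /andP[x0 xH]].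
move=> /andP[/andP[y0 yH] /andP[z0 zH]] m0 ac bc mx my mz axy bxz cyz.
have mH : m <= H by lra.
have amb : a * b * m = a * m * b by ring.
have bma : a * b * m = b * m * a by ring.
case/andP: ij; case: i => [|[|[|[|[|[|i]]]]]];
  case: j => [|[|[|[|[|[|j]]]]]] //= _ _.
- by apply: le_mul3 => //; apply: le_mul2.
- by apply: le_mul3 => //; apply: le_mul2.
- by rewrite amb; apply: le_mul3 => //; apply: le_mul2.
- by rewrite amb; apply: le_mul3 => //; apply: le_mul2.
- by rewrite amb; apply: le_mul3 => //; apply: le_mul2.
- by rewrite (mulrC a); apply: le_mul3 => //; apply: le_mul2.
- by rewrite bma; apply: le_mul3 => //; apply: le_mul2.
- by rewrite bma; apply: le_mul3 => //; apply: le_mul2.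
- by rewrite bma; apply: le_mul3 => //; apply: le_mul2.
- by rewrite amb; apply: le_mul3 => //; apply: le_mul2.
- by rewrite amb; apply: le_mul3 => //; apply: le_mul2.
- by rewrite amb; apply: le_mul3 => //; apply: le_mul2.
- by rewrite amb; apply: le_mul3 => //; apply: le_mul_sum.
- by rewrite bma; apply: le_mul3 => //; apply: le_mul_sum.
- by rewrite amb; apply: le_mul3 => //; apply: le_mul_sum => //; lra.
Qed.

(** The edge [e] is common to two faces with other sides [b], [c] and [x], [y],
    of heights [r] and [s] on [e], and [z] is the opposite edge.  The
    bounds of [r] and [s] by [z] hold for an obtuse angle only. *)
Lemma obtuse_dihedral_product e r s b c x y z H
    (t := [:: e; b; c; x; y; z]) i j :
  (i < j < 6)%N -> all (fun t => 0 <= t <= H) t -> 0 <= r -> 0 <= s ->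
  r <= b -> r <= c -> r <= z -> s <= x -> s <= y -> s <= z ->
  e <= b + c -> e <= x + y ->
  e * r * s <= 2 * (t`_i * t`_j) * H.
Proof.
move=> ij; rewrite /t /= andbT.
move=> /and5P[/andP[e0 eH] /andP[b0 bH] /andP[c0 cH] /andP[x0 xH]].
move=> /andP[/andP[y0 yH] /andP[z0 zH]] r0 s0 rb rc rz sx sy sz ebc exy.
have esr : e * r * s = e * s * r by ring.
have rse : e * r * s = r * s * e by ring.
have rH : r <= H by lra.
have sH : s <= H by lra.
case/andP: ij; case: i => [|[|[|[|[|[|i]]]]]];
  case: j => [|[|[|[|[|[|j]]]]]] //= _ _.
- by apply: le_mul3 => //; apply: le_mul2.
- by apply: le_mul3 => //; apply: le_mul2.
- by rewrite esr; apply: le_mul3 => //; apply: le_mul2.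
- by rewrite esr; apply: le_mul3 => //; apply: le_mul2.
- by rewrite esr; apply: le_mul3 => //; apply: le_mul2.
- by apply: le_mul3 => //; apply: le_mul_sum.
- by rewrite rse; apply: le_mul3 => //; apply: le_mul2.
- by rewrite rse; apply: le_mul3 => //; apply: le_mul2.
- by rewrite rse; apply: le_mul3 => //; apply: le_mul2.
- by rewrite rse; apply: le_mul3 => //; apply: le_mul2.
- by rewrite rse; apply: le_mul3 => //; apply: le_mul2.
- by rewrite rse; apply: le_mul3 => //; apply: le_mul2.
- by rewrite esr; apply: le_mul3 => //; apply: le_mul_sum.
- by rewrite rse (mulrC r); apply: le_mul3 => //; apply: le_mul2.
- by rewrite rse (mulrC r); apply: le_mul3 => //; apply: le_mul2.
Qed.

(** By the law of cosines the right-hand side is [(x y sin)^2] for the largest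
    angle, whose cosine lies between [- k] and 1/2. *)
Lemma triangle_area_sorted k x y z : 0 <= k <= 1 ->
  0 <= x -> x <= y -> y <= z -> z <= x + y ->
  - (k * 2 * x * y) <= x ^+ 2 + y ^+ 2 - z ^+ 2 ->
  (1 - k) / 8 * x ^+ 2 * z ^+ 2 <=
    x ^+ 2 * y ^+ 2 - ((x ^+ 2 + y ^+ 2 - z ^+ 2) / 2) ^+ 2.
Proof.
move=> /andP[k0 k1] x0 xy yz zxy; set t := _ / 2 => H.
have t1 : - k * (x * y) <= t by rewrite /t; lra.
have t2 : t <= x * y / 2 by rewrite /t; nra.
have xy0 : 0 <= x * y by nra.
have -> : x ^+ 2 * y ^+ 2 - t ^+ 2 = (x * y - t) * (x * y + t) by ring.
have h : x * z <= x * y * 2 by nra.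
have xz0 : 0 <= x * z by nra.
apply: (@le_trans _ _ ((x * y / 2) * ((1 - k) * (x * y)))); last first.
  by apply: ler_pM; nra.
have : (x * z) ^+ 2 <= (x * y * 2) ^+ 2 by rewrite ler_sqr ?nnegrE//; nra.
nra.
Qed.

End Numeric.

(** * Angles *)

Section Angles.
Variable R : realType.
Implicit Types (u v w e : 'rV[R]_3) (x y k : R).

Lemma ler_acos x y : -1 <= x <= 1 -> -1 <= y <= 1 ->
  (acos x <= acos y) = (y <= x).
Proof.
move=> hx hy; have acos_itv z : -1 <= z <= 1 -> acos z \in `[0, pi].
  by move=> hz; rewrite in_itv/= acos_ge0// acos_lepi.
by rewrite !leNgt -ltr_cos ?acos_itv// !acosK// in_itv.
Qed.

(** Stated without quotients, the comparison also covers zero vectors, for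
    which the angle is [acos 0] by convention. *)
Lemma angle_le_acosN k u v : 0 <= k <= 1 ->
  (angle u v <= acos (- k)) = (- (k * (enorm u * enorm v)) <= dot u v).
Proof.
move=> /andP[k0 k1]; rewrite /angle.
have := cauchy_schwarz u v; set X := enorm u * enorm v.
have X0 : 0 <= X by rewrite mulr_ge0 ?enorm_ge0.
rewrite ler_norml => /andP[d1 d2].
have [XE|Xn0] := eqVneq X 0.
  have dE : dot u v = 0 by move: d1 d2; rewrite XE; lra.
  by rewrite dE XE invr0 !mulr0 ler_acos; lra.
have Xp : 0 < X by rewrite lt_neqAle eq_sym Xn0.
rewrite ler_acos; [|by rewrite ler_pdivlMr// ler_pdivrMr//; lra|lra].
by rewrite ler_pdivlMr// mulNr.
Qed.

(** Both ends of the edge [e] see the same height of a third point. *)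
Lemma orth_part_shift e v : e != 0 -> orth_part e (v - e) = orth_part e v.
Proof.
rewrite -dot_eq0 => e0; rewrite /orth_part.
have -> : dot (v - e) e = dot v e - dot e e by rewrite !vecE/=; ring.
by rewrite mulrBl divff// scalerBl scale1r opprB addrA subrK.
Qed.

Lemma orth_partB e v w : orth_part e v - orth_part e w = orth_part e (v - w).
Proof.
rewrite /orth_part.
have -> : dot (v - w) e = dot v e - dot w e by rewrite !vecE/=; ring.
by apply/rowP => i; rewrite !mxE mulrBl; ring.
Qed.

Lemma enorm_gt0 u : (0 < enorm u) = (u != 0).
Proof. by rewrite sqrtr_gt0 lt_neqAle dot_ge0 andbT eq_sym dot_eq0. Qed.

Lemma enorm_orth_part_cross e v : e != 0 ->
  enorm (orth_part e v) * enorm e = enorm (cross e v).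
Proof.
by move=> e0; rewrite /enorm -sqrtrM ?dot_ge0// dot_orth_part.
Qed.

Lemma enorm_orth_part_le e v : e != 0 -> enorm (orth_part e v) <= enorm v.
Proof.
move=> e0; have ep : 0 < enorm e by rewrite enorm_gt0.
rewrite -(ler_pM2r ep) enorm_orth_part_cross//.
rewrite -ler_sqr ?nnegrE ?mulr_ge0 ?enorm_ge0//.
by rewrite exprMn !enorm_sqr dot_cross mulrC lerBlDr lerDl sqr_ge0.
Qed.

Lemma polarization (a b c : 'rV[R]_3) : dot (b - a) (c - a) =
  (dist a b ^+ 2 + dist a c ^+ 2 - dist b c ^+ 2) / 2.
Proof. by rewrite /dist !enorm_sqr !vecE/=; field. Qed.

End Angles.

(** * A bounded ratio keeps the angles away from pi *)

Section RatioToAngles.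
Variable R : realType.
Implicit Types T : tetrahedron R.

(** The absolute value of the cosine of an angle of sine [1 / (2 * D)]. *)
Definition cos_gap (D : R) : R := Num.sqrt (1 - (2 * D) ^- 2).

Lemma cos_gap_itv D : 1 <= D -> 0 <= cos_gap D < 1.
Proof.
move=> D1; rewrite sqrtr_ge0/= -[ltRHS]sqrtr1 ltr_sqrt ?ltr01//.
by rewrite gtrBl invr_gt0 exprn_gt0//; lra.
Qed.

Lemma cos_gap_bound D X d : 1 <= D -> 0 <= X ->
  X ^+ 2 <= (2 * D) ^+ 2 * (X ^+ 2 - d ^+ 2) -> - (cos_gap D * X) <= d.
Proof.
move=> D1 X0 H; have D20 : 0 < (2 * D) ^+ 2 by rewrite exprn_gt0//; lra.
have D21 : 1 <= (2 * D) ^+ 2 by rewrite expr_ge1//; lra.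
suff : `|d| <= cos_gap D * X by rewrite ler_norml => /andP[].
rewrite -ler_sqr ?nnegrE ?mulr_ge0 ?sqrtr_ge0// real_normK ?num_real//.
rewrite exprMn sqr_sqrtr; last by rewrite subr_ge0 invf_le1.
rewrite -(ler_pM2l D20).
have -> : (2 * D) ^+ 2 * ((1 - (2 * D) ^- 2) * X ^+ 2) =
    (2 * D) ^+ 2 * X ^+ 2 - X ^+ 2 by field; lra.
move: H; lra.
Qed.

(** The product of the two smallest lengths ignores their order, so that their
    positions can be taken increasing. *)
Let edges_and_smallest_product T i j k l : uniq [:: i; j; k; l] ->
  let q := vertex T in
  let s := [:: dist (q i) (q j); dist (q i) (q k);
    dist (q j) (q k); dist (q i) (q l); dist (q j) (q l); dist (q k) (q l)] in
  all (fun t => 0 <= t <= hT T) s /\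
  exists m n, (m < n < 6)%N /\ h1 T * h2 T = s`_m * s`_n.
Proof.
move=> U q s; split; first by rewrite /= !enorm_ge0 !dist_le_hT.
rewrite /h1 /h2 (edge_lengthsE T U).
have [//|m [n [mn n6 ->]]] := @sort_two_smallest_attained R s.
by exists m, n; rewrite mn n6.
Qed.

Lemma fourth_vertex (i j k : 'I_4) : uniq [:: i; j; k] ->
  exists l, uniq [:: i; j; k; l].
Proof.
move=> U; have /subsetPn[l _ lU] : ~~ ('I_4 \subset [:: i; j; k]).
  apply/negP => /subset_leq_card; rewrite card_ord leqNgt ltnS.
  by rewrite (leq_trans (card_size _)).
by exists l; rewrite (rcons_uniq [:: i; j; k] l) lU.
Qed.

(** Both sides of the claim that [|u| |v| m] is at most
    [2 * h1 * h2 * hT <= 2 * D * W] are squared and compared with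
    [W ^ 2 <= (|u| |v| sin) ^ 2 * m ^ 2]. *)
Lemma face_angle_le_of_ratio T D i j k : 1 <= D ->
  h1 T * h2 T * hT T <= D * span_volume T -> uniq [:: i; j; k] ->
  face_angle T i j k <= acos (- cos_gap D).
Proof.
move=> D1 HD /fourth_vertex[l U].
have /andP[g0 g1] := cos_gap_itv D1.
rewrite /face_angle angle_le_acosN ?g0 ?(ltW g1)//.
set q := vertex T; set u := q j - q i; set v := q k - q i.
have X0 : 0 <= enorm u * enorm v by rewrite mulr_ge0 ?enorm_ge0.
have [d0|d0] := lerP 0 (dot u v).
  by apply: le_trans d0; rewrite oppr_le0 mulr_ge0.
have [se [a [b [ab hE]]]] := edges_and_smallest_product T U.
have W0 := span_volume_gt0 T; have W2 := mixed_at_sqr T U.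
rewrite -/q in hE se.
have uE : enorm u = dist (q i) (q j) by rewrite distC.
have vE : enorm v = dist (q i) (q k) by rewrite distC.
set w := q l - q i.
pose m := Num.min (dist (q i) (q l))
  (Num.min (dist (q j) (q l)) (dist (q k) (q l))).
have m0 : 0 <= m by rewrite !le_min !enorm_ge0.
have Gm : span_volume T ^+ 2 <=
    ((enorm u * enorm v) ^+ 2 - dot u v ^+ 2) * m ^+ 2.
  (* each edge from the fourth vertex to the face spans the same volume *)
  have far (z : 'rV[R]_3) : mixed u v z = mixed_at T i j k l ->
      span_volume T ^+ 2 <=
        ((enorm u * enorm v) ^+ 2 - dot u v ^+ 2) * enorm z ^+ 2.
    by move=> zE; rewrite exprMn !enorm_sqr -W2 -zE mixed_sqr_le.
  rewrite /m /Num.min; case: ifP => _; last case: ifP => _.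
  - by rewrite distC; apply: far.
  - rewrite distC; apply: far.
    by rewrite /mixed_at -/q /mixed /triple !vecE /=; ring.
  - rewrite distC; apply: far.
    by rewrite /mixed_at -/q /mixed /triple !vecE /=; ring.
have mn0 : 0 < m ^+ 2.
  rewrite lt_neqAle sqr_ge0 andbT eq_sym; apply/eqP => mE.
  by move: Gm; rewrite mE mulr0 leNgt exprn_gt0.
have dE := polarization (q i) (q j) (q k); rewrite -/u -/v in dE.
have abm : enorm u * enorm v * m <= 2 * (h1 T * h2 T) * hT T.
  rewrite hE uE vE.
  apply: (obtuse_face_product ab se m0).
  - rewrite -ler_sqr ?nnegrE ?enorm_ge0//.
    by move: dE d0 (sqr_ge0 (dist (q i) (q k))); lra.
  - rewrite -ler_sqr ?nnegrE ?enorm_ge0//.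
    by move: dE d0 (sqr_ge0 (dist (q i) (q j))); lra.
  - by rewrite /m !ge_min lexx.
  - by rewrite /m !ge_min lexx !orbT.
  - by rewrite /m !ge_min lexx !orbT.
  - by rewrite [dist (q j) (q l)]distC dist_triangle.
  - by rewrite [dist (q k) (q l)]distC dist_triangle.
  - by rewrite [dist (q k) (q l)]distC dist_triangle.
apply: cos_gap_bound => //.
rewrite -(ler_pM2r mn0) -exprMn.
apply: (@le_trans _ _ ((2 * D * span_volume T) ^+ 2)).
  rewrite ler_sqr ?nnegrE; [lra|by rewrite mulr_ge0|].
  by rewrite mulr_ge0 ?(ltW W0)//; lra.
by rewrite [leLHS]exprMn -[leRHS]mulrA ler_wpM2l ?sqr_ge0.
Qed.

(** The same comparison as for faces, now with the equality
    [W = |e| |u| |v| sin], where [u] and [v] are the heights on the edge [e]. *)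
Lemma dihedral_angle_le_of_ratio T D i j k l : 1 <= D ->
  h1 T * h2 T * hT T <= D * span_volume T -> uniq [:: i; j; k; l] ->
  dihedral_angle T i j k l <= acos (- cos_gap D).
Proof.
move=> D1 HD U.
have /andP[g0 g1] := cos_gap_itv D1.
rewrite /dihedral_angle angle_le_acosN ?g0 ?(ltW g1)//.
set q := vertex T; set e := q j - q i.
set u := orth_part e _; set v := orth_part e _.
have X0 : 0 <= enorm u * enorm v by rewrite mulr_ge0 ?enorm_ge0.
have [d0|d0] := lerP 0 (dot u v).
  by apply: le_trans d0; rewrite oppr_le0 mulr_ge0.
have [se [a [b [ab hE]]]] := edges_and_smallest_product T U.
have W0 := span_volume_gt0 T; have W2 := mixed_at_sqr T U.
rewrite -/q in hE se.
have e0 : e != 0 by exact: edge_neq0 U.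
have ep : 0 < enorm e by rewrite enorm_gt0.
have Wuv : span_volume T ^+ 2 =
    enorm e ^+ 2 * ((enorm u * enorm v) ^+ 2 - dot u v ^+ 2).
  have := mixed_sqr_cross e (q k - q i) (q l - q i).
  rewrite -!dot_orth_part// -/u -/v -/(mixed_at T i j k l) W2.
  rewrite !exprMn !enorm_sqr => H.
  have E0 : dot e e != 0 by rewrite dot_eq0.
  by apply: (mulIf E0); rewrite H; ring.
have rk : enorm u <= dist (q i) (q k) by rewrite distC enorm_orth_part_le.
have sl : enorm v <= dist (q i) (q l) by rewrite distC enorm_orth_part_le.
have shift x : x - q j = x - q i - e by rewrite /e opprB addrA subrK.
have rj : enorm u <= dist (q j) (q k).
  by rewrite distC /u -orth_part_shift// -shift enorm_orth_part_le.
have sj : enorm v <= dist (q j) (q l).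
  by rewrite distC /v -orth_part_shift// -shift enorm_orth_part_le.
have kl : dot (u - v) (u - v) <= dist (q k) (q l) ^+ 2.
  rewrite -enorm_sqr ler_sqr ?nnegrE ?enorm_ge0// /u /v orth_partB.
  by rewrite opprB addrA subrK enorm_orth_part_le.
have uvE : dot (u - v) (u - v) = enorm u ^+ 2 + enorm v ^+ 2 - 2 * dot u v.
  by rewrite !enorm_sqr dot_diff.
(* an obtuse angle between the heights is opposite to the longest side *)
have ru : enorm u <= dist (q k) (q l).
  rewrite -ler_sqr ?nnegrE ?enorm_ge0//.
  by move: kl uvE d0 (sqr_ge0 (enorm v)); lra.
have sv : enorm v <= dist (q k) (q l).
  rewrite -ler_sqr ?nnegrE ?enorm_ge0//.
  by move: kl uvE d0 (sqr_ge0 (enorm u)); lra.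
have ers : enorm e * enorm u * enorm v <= 2 * (h1 T * h2 T) * hT T.
  rewrite hE; have -> : enorm e = dist (q i) (q j) by rewrite distC.
  apply: (obtuse_dihedral_product ab se) => //; try exact: enorm_ge0.
    by rewrite [dist (q j) (q k)]distC dist_triangle.
  by rewrite [dist (q j) (q l)]distC dist_triangle.
apply: cos_gap_bound => //.
have ep2 : 0 < enorm e ^+ 2 by rewrite exprn_gt0.
rewrite -(ler_pM2l ep2) [leRHS]mulrCA -Wuv -!exprMn.
rewrite ler_sqr ?nnegrE; [lra|by rewrite !mulr_ge0 ?enorm_ge0|].
by rewrite mulr_ge0 ?(ltW W0)//; lra.
Qed.

End RatioToAngles.

(** * Angles away from pi bound the ratio *)

Lemma uniq_perm3 (T : eqType) (a b c : T) : uniq [:: a; b; c] ->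
  uniq [:: b; a; c] /\ uniq [:: c; a; b].
Proof.
by move=> U; split; rewrite (@perm_uniq _ _ [:: a; b; c])//;
  apply/permP => p /=; lia.
Qed.

Lemma uniq_perm4 (T : eqType) (a b c d : T) : uniq [:: a; b; c; d] ->
  [/\ uniq [:: a; c; b; d], uniq [:: a; b; d; c], uniq [:: a; c; d; b] &
      uniq [:: a; d; b; c]].
Proof.
by move=> U; split; rewrite (@perm_uniq _ _ [:: a; b; c; d])//;
  apply/permP => p /=; lia.
Qed.

Section AnglesToRatio.
Variable R : realType.
Implicit Types (T : tetrahedron R) (k : R).

(** [triangle_area_sorted] applied to the sorted sides, with [a] the first and
    [c] the last of them. *)
Lemma triangle_area k (x y z : R) : 0 <= k <= 1 ->
  0 <= x -> 0 <= y -> 0 <= z ->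
  z <= x + y -> x <= y + z -> y <= x + z ->
  - (k * 2 * x * y) <= x ^+ 2 + y ^+ 2 - z ^+ 2 ->
  - (k * 2 * x * z) <= x ^+ 2 + z ^+ 2 - y ^+ 2 ->
  - (k * 2 * y * z) <= y ^+ 2 + z ^+ 2 - x ^+ 2 ->
  exists a c, [/\ a \in [:: x; y; z], x <= c, y <= c, z <= c &
    (1 - k) / 8 * a ^+ 2 * c ^+ 2 <=
      x ^+ 2 * y ^+ 2 - ((x ^+ 2 + y ^+ 2 - z ^+ 2) / 2) ^+ 2].
Proof.
move=> k01; pose G (x y z : R) :=
  x ^+ 2 * y ^+ 2 - ((x ^+ 2 + y ^+ 2 - z ^+ 2) / 2) ^+ 2.
have Gyx u v w : G u v w = G v u w by rewrite /G; field.
have Gzy u v w : G u v w = G u w v by rewrite /G; field.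
rewrite -/(G x y z).
have sorted u v w : 0 <= u -> u <= v -> v <= w -> w <= u + v ->
    - (k * 2 * u * v) <= u ^+ 2 + v ^+ 2 - w ^+ 2 -> G x y z = G u v w ->
    u \in [:: x; y; z] -> x <= w -> y <= w -> z <= w ->
    exists a c, [/\ a \in [:: x; y; z], x <= c, y <= c, z <= c &
      (1 - k) / 8 * a ^+ 2 * c ^+ 2 <= G x y z].
  move=> u0 uv vw wuv H GE ui xw yw zw; exists u, w; split=> //.
  by rewrite GE; exact: triangle_area_sorted.
move=> x0 y0 z0 zxy xyz yxz Hz Hy Hx.
have [xy|/ltW yx] := lerP x y; have [yz|/ltW zy] := lerP y z;
  have [xz|/ltW zx] := lerP x z.
- by apply: (sorted x y z); rewrite ?inE ?eqxx ?orbT.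
- by apply: (sorted x y z); rewrite ?inE ?eqxx ?orbT//; lra.
- by apply: (sorted x z y); rewrite ?inE ?eqxx ?orbT.
- apply: (sorted z x y); rewrite ?inE ?eqxx ?orbT//; try lra.
  by rewrite Gzy Gyx.
- apply: (sorted y x z); rewrite ?inE ?eqxx ?orbT//; try lra.
- apply: (sorted y z x); rewrite ?inE ?eqxx ?orbT//; try lra.
  by rewrite Gyx Gzy.
- apply: (sorted z y x); rewrite ?inE ?eqxx ?orbT//; try lra.
  by rewrite Gzy Gyx Gzy.
- apply: (sorted z y x); rewrite ?inE ?eqxx ?orbT//; try lra.
  by rewrite Gzy Gyx Gzy.
Qed.

(** Were [n1] nearly opposite to both [n2] and [n3], these two would nearly
    coincide.  For unit vectors this is the nonnegativity of
    [|2 n1 + n2 + n3| ^ 2], and [c] is the value at which it becomes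
    contradictory. *)
Lemma antipodal_normals k (n1 n2 n3 : 'rV[R]_3) :
  n1 != 0 -> n2 != 0 -> n3 != 0 ->
  dot n2 n3 <= k * (enorm n2 * enorm n3) ->
  let c := 1 - (1 - k) / 4 in
  - (c * (enorm n1 * enorm n2)) <= dot n1 n2 \/
  - (c * (enorm n1 * enorm n3)) <= dot n1 n3.
Proof.
move=> n10 n20 n30 H c.
have := n10; rewrite -enorm_gt0; have := n20; rewrite -enorm_gt0.
have := n30; rewrite -enorm_gt0.
have N1E := enorm_sqr n1; have N2E := enorm_sqr n2; have N3E := enorm_sqr n3.
move: N1E N2E N3E H.
set N1 := enorm n1; set N2 := enorm n2; set N3 := enorm n3.
move=> N1E N2E N3E H N3p N2p N1p.
have [|h2] := lerP (- (c * (N1 * N2))) (dot n1 n2); first by left.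
right; rewrite leNgt; apply/negP => h3.
(* the combination 2 n1 + n2 + n3 of the unit vectors, times N1 N2 N3 *)
have := dot_ge0 ((2 * N2 * N3) *: n1 + ((N1 * N3) *: n2 + (N1 * N2) *: n3)).
have -> : forall x y z, dot (x *: n1 + (y *: n2 + z *: n3))
    (x *: n1 + (y *: n2 + z *: n3)) =
  x ^+ 2 * dot n1 n1 + y ^+ 2 * dot n2 n2 + z ^+ 2 * dot n3 n3
  + 2 * x * y * dot n1 n2 + 2 * x * z * dot n1 n3 + 2 * y * z * dot n2 n3.
  by move=> x y z; rewrite !vecE/=; ring.
rewrite -N1E -N2E -N3E leNgt => /negP; apply.
set P := N1 * N2 * N3; have P0 : 0 < P by rewrite !mulr_gt0.
have b2 : P * N3 * dot n1 n2 < - (c * P ^+ 2).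
  rewrite (_ : - (c * P ^+ 2) = P * N3 * - (c * (N1 * N2))).
    by rewrite ltr_pM2l ?mulr_gt0.
  by rewrite /P; ring.
have b3 : P * N2 * dot n1 n3 < - (c * P ^+ 2).
  rewrite (_ : - (c * P ^+ 2) = P * N2 * - (c * (N1 * N3))).
    by rewrite ltr_pM2l ?mulr_gt0.
  by rewrite /P; ring.
have b1 : P * N1 * dot n2 n3 <= k * P ^+ 2.
  rewrite (_ : k * P ^+ 2 = P * N1 * (k * (N2 * N3))).
    by rewrite ler_pM2l ?mulr_gt0.
  by rewrite /P; ring.
rewrite [ltLHS](_ : _ = 6 * P ^+ 2 + 4 * (P * N3 * dot n1 n2)
  + 4 * (P * N2 * dot n1 n3) + 2 * (P * N1 * dot n2 n3)).
  have cE : c * P ^+ 2 = P ^+ 2 - P ^+ 2 / 4 + k * P ^+ 2 / 4.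
    by rewrite /c; field.
  by move: b1 b2 b3; rewrite cE; lra.
by rewrite /P; ring.
Qed.

Section BoundedAngles.
Variables (T : tetrahedron R) (k : R).
Hypotheses (k01 : 0 <= k < 1)
  (faces : forall i j l, uniq [:: i; j; l] -> face_angle T i j l <= acos (- k))
  (dihedrals : forall i j l m, uniq [:: i; j; l; m] ->
     dihedral_angle T i j l m <= acos (- k)).
Let q := vertex T.

Let k01' : 0 <= k <= 1. Proof. by case/andP: k01 => -> /ltW. Qed.

(** The law of cosines turns the bound of a face angle into one for
    lengths. *)
Let face_law i j l : uniq [:: i; j; l] ->
  - (k * 2 * dist (q i) (q j) * dist (q i) (q l)) <=
    dist (q i) (q j) ^+ 2 + dist (q i) (q l) ^+ 2 - dist (q j) (q l) ^+ 2.
Proof.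
move=> /faces; rewrite /face_angle angle_le_acosN// -/q polarization.
by rewrite -/(dist (q j) (q i)) -/(dist (q l) (q i)) ![dist _ (q i)]distC; lra.
Qed.

Let face_area i j l : uniq [:: i; j; l] ->
  exists a c, [/\
    a \in [:: dist (q i) (q j); dist (q i) (q l); dist (q j) (q l)],
    dist (q i) (q j) <= c, dist (q i) (q l) <= c, dist (q j) (q l) <= c &
    (1 - k) / 8 * a ^+ 2 * c ^+ 2 <=
      enorm (cross (q j - q i) (q l - q i)) ^+ 2].
Proof.
move=> U; rewrite enorm_sqr dot_cross (polarization (q i) (q j) (q l)).
rewrite -!enorm_sqr -/(dist (q j) (q i)) -/(dist (q l) (q i)).
rewrite ![dist _ (q i)]distC.
have [Uj Ul] := uniq_perm3 U.
have := face_law U; have := face_law Uj; have := face_law Ul.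
rewrite [dist (q j) (q i)]distC [dist (q l) (q i)]distC [dist (q l) (q j)]distC.
move=> Hl Hj Hi; apply: (triangle_area k01') => //; try exact: enorm_ge0.
- by rewrite [dist (q i) (q j)]distC dist_triangle.
- by rewrite [dist (q j) (q l)]distC dist_triangle.
by rewrite dist_triangle.
Qed.

Let dihedral_law i j l m (e := q j - q i) (a := cross e (q l - q i))
    (b := cross e (q m - q i)) : uniq [:: i; j; l; m] ->
  - (k * (enorm a * enorm b)) <= dot a b.
Proof.
move=> U.
have e0 : e != 0 by exact: edge_neq0 U.
have := dihedrals U; rewrite /dihedral_angle angle_le_acosN// -/q -/e.
have E0 : 0 < dot e e by rewrite lt_neqAle dot_ge0 eq_sym dot_eq0 e0.
rewrite -(ler_pM2r E0) dot_orth_part// -/a -/b -enorm_sqr.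
rewrite /a /b -!enorm_orth_part_cross//; congr (_ <= _); ring.
Qed.

(** The upper bound on [dot a b] says that the dihedral angle along [oj] is not
    nearly zero.  The hypothesis on [oi] is what separates the shortest sides of
    the two faces: the common edge [oj] may be replaced by [oi] in the
    face [oij]. *)
Lemma ratio_le_of_good_edge o i j l : uniq [:: o; i; j; l] ->
  dist (q o) (q i) <= dist (q o) (q j) ->
  let e := q j - q o in let a := cross e (q i - q o) in
  let b := cross e (q l - q o) in
  dot a b <= (1 - (1 - k) / 4) * (enorm a * enorm b) ->
  (1 - k) ^+ 2 * (h1 T * h2 T * hT T) <= 32 * span_volume T.
Proof.
move=> U oij e a b good.
have Uij : uniq [:: o; i; j] by exact: mask_uniq U [:: true; true; true].
have Ujl : uniq [:: o; j; l].
  by exact: mask_uniq U [:: true; false; true; true].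
have [Uji _ _ _] := uniq_perm4 U.
have [a1 [c1 [a1E oi1 oj1 ij1 A1]]] := face_area Uij.
have [a2 [c2 [a2E oj2 ol2 jl2 A2]]] := face_area Ujl.
have aE : enorm (cross (q i - q o) (q j - q o)) = enorm a.
  by rewrite /enorm; congr Num.sqrt; rewrite /a /cross !vecE/=; ring.
rewrite aE in A1; rewrite -/e -/b in A2.
have W0 := span_volume_gt0 T.
have e0 : 0 < enorm e by rewrite enorm_gt0; exact: edge_neq0 Uji.
have We : span_volume T ^+ 2 * enorm e ^+ 2 =
    (enorm a * enorm b) ^+ 2 - dot a b ^+ 2.
  have := mixed_sqr_cross e (q i - q o) (q l - q o); rewrite -/a -/b.
  by rewrite -/(mixed_at T o j i l) mixed_at_sqr// exprMn !enorm_sqr.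
have law : - (k * (enorm a * enorm b)) <= dot a b.
  exact: dihedral_law Uji.
have [k0 k1] := andP k01.
set X := enorm a * enorm b in We good law.
have X0 : 0 <= X by rewrite mulr_ge0 ?enorm_ge0.
(* (1 - k) ^ 2 / 4 bounds from below the squared sine of the dihedral angle *)
have sin2 : (1 - k) ^+ 2 / 4 * X ^+ 2 <= X ^+ 2 - dot a b ^+ 2.
  rewrite subr_sqr.
  rewrite (_ : _ / 4 * X ^+ 2 = ((1 - k) / 4 * X) * ((1 - k) * X));
    last by field.
  by apply: ler_pM; [apply: mulr_ge0 => //; lra|apply: mulr_ge0 => //; lra|
    lra|lra].
have ge0 (x y : 'rV[R]_3) : 0 <= dist x y by exact: enorm_ge0.
have a10 : 0 <= a1 by move: a1E; rewrite !inE => /or3P[] /eqP ->.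
have a20 : 0 <= a2 by move: a2E; rewrite !inE => /or3P[] /eqP ->.
have ee : enorm e = dist (q o) (q j) by rewrite distC.
pose C := Num.max c1 c2.
(* the edge e is a side of both faces, so it is at most c1 and at most c2 *)
have cC : enorm e * C <= c1 * c2.
  have ? := ltW e0; rewrite /C /Num.max; case: ifP => _; last rewrite mulrC.
    by apply: ler_wpM2r; [exact: le_trans (ge0 _ _) oj2|rewrite ee].
  by apply: ler_wpM2l; [exact: le_trans (ge0 _ _) oj1|rewrite ee].
have C0 : 0 <= C by rewrite le_max (le_trans (ge0 _ _) oj1).
have low : ((1 - k) ^+ 2 * (a1 * a2 * C)) ^+ 2 <= (16 * span_volume T) ^+ 2.
  (* multiplied by the square of e, this follows from sin2 and both areas *)
  have A12 : ((1 - k) / 8) ^+ 2 * (a1 * a2 * (c1 * c2)) ^+ 2 <= X ^+ 2.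
    rewrite (_ : _ * _ = ((1 - k) / 8 * a1 ^+ 2 * c1 ^+ 2) *
      ((1 - k) / 8 * a2 ^+ 2 * c2 ^+ 2)); last by ring.
    by rewrite exprMn; apply: ler_pM => //;
      rewrite !mulr_ge0 ?sqr_ge0//; lra.
  have EC : (enorm e * (a1 * a2 * C)) ^+ 2 <= (a1 * a2 * (c1 * c2)) ^+ 2.
    rewrite ler_sqr ?nnegrE; first last.
    - by rewrite !mulr_ge0// (le_trans (ge0 _ _) oj1, le_trans (ge0 _ _) oj2).
    - by rewrite !mulr_ge0// ltW.
    by rewrite mulrCA; apply: ler_wpM2l => //; exact: mulr_ge0.
  have e2 : 0 < enorm e ^+ 2 by rewrite exprn_gt0.
  rewrite -(ler_pM2r e2).
  have kk : 0 <= (1 - k) ^+ 2 by exact: sqr_ge0.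
  rewrite [(16 * _) ^+ 2]exprMn -[leRHS]mulrA We.
  apply: le_trans (ler_wpM2l _ sin2); last by rewrite sqr_ge0.
  rewrite (_ : 16 ^+ 2 * _ = (8 * (1 - k)) ^+ 2 * X ^+ 2); last by field.
  apply: le_trans (ler_wpM2l _ A12); last by rewrite sqr_ge0.
  rewrite [leRHS](_ : _ = ((1 - k) ^+ 2) ^+ 2 * (a1 * a2 * (c1 * c2)) ^+ 2).
    rewrite [leLHS](_ : _ =
        ((1 - k) ^+ 2) ^+ 2 * (enorm e * (a1 * a2 * C)) ^+ 2).
      by apply: ler_wpM2l => //; rewrite sqr_ge0.
    by ring.
  by field.
have W16 : (1 - k) ^+ 2 * (a1 * a2 * C) <= 16 * span_volume T.
  rewrite -ler_sqr ?nnegrE//.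
    by apply: mulr_ge0; rewrite ?sqr_ge0 ?mulr_ge0.
  by rewrite mulr_ge0 ?(ltW W0).
have hT2 : hT T <= 2 * C.
  apply: (@hT_ub _ T o) => m.
  have : m \in [:: o; i; j; l].
    apply: contraT => mU; have := max_card [in m :: [:: o; i; j; l]].
    by rewrite (card_uniqP _) ?card_ord//= mU.
  rewrite !inE -/q => /or4P[] /eqP ->; rewrite ?[dist _ (q o)]distC /C le_max.
  - rewrite [X in X <= _](_ : _ = 0) ?(le_trans (ge0 _ _) oj1)//.
    by apply/eqP; rewrite /dist subrr sqrtr_eq0 le_eqVlt dot_eq0 eqxx.
  - by rewrite oi1.
  - by rewrite oj1.
  - by rewrite ol2 orbT.
have h12 : h1 T * h2 T <= a1 * a2.
  pose s := [:: dist (q o) (q i); dist (q o) (q j); dist (q i) (q j);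
     dist (q o) (q l); dist (q i) (q l); dist (q j) (q l)].
  have small m n : (m < 6)%N -> (n < 6)%N -> m != n ->
      h1 T * h2 T <= s`_m * s`_n.
    move=> m6 n6 mn; rewrite /h1 /h2 (edge_lengthsE T U) -/q -/s.
    by apply: sort_two_smallest_le => //; rewrite /= !ge0.
  move: a1E; rewrite !inE => /or3P[] /eqP ->.
  - move: a2E; rewrite !inE => /or3P[] /eqP ->.
    + exact: (small 0%N 1%N).
    + exact: (small 0%N 3%N).
    + exact: (small 0%N 5%N).
  - apply: (@le_trans _ _ (dist (q o) (q i) * a2)); last by apply: ler_wpM2r.
    move: a2E; rewrite !inE => /or3P[] /eqP ->.
    + exact: (small 0%N 1%N).
    + exact: (small 0%N 3%N).
    + exact: (small 0%N 5%N).
  - move: a2E; rewrite !inE => /or3P[] /eqP ->.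
    + exact: (small 2%N 1%N).
    + exact: (small 2%N 3%N).
    + exact: (small 2%N 5%N).
have hT0 : 0 <= hT T by apply: le_trans (ge0 _ _) (dist_le_hT T o o).
have kk : 0 <= (1 - k) ^+ 2 by exact: sqr_ge0.
have : h1 T * h2 T * hT T <= 2 * (a1 * a2 * C).
  rewrite (_ : 2 * _ = (a1 * a2) * (2 * C)); last by ring.
  have sorted_ge0 n : 0 <= (edge_lengths T)`_n.
    rewrite (edge_lengthsE T U) -/q; have [nlt|] := ltnP n 6; last first.
      by move=> ?; rewrite nth_default// size_sort.
    by apply: (all_nthP 0 _ n); rewrite ?size_sort//= all_sort /= !ge0.
  by apply: ler_pM => //; apply: mulr_ge0; exact: sorted_ge0.
move=> /(ler_wpM2l kk) H; apply: le_trans H _.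
by rewrite mulrCA; move: W16; lra.
Qed.

(** Applies [antipodal_normals] at a vertex [o] with nearest vertex [i]; [n1] is
    normal to the face of the two longer edges [oj] and [ol], so that the
    alternative is which of these two is good. *)
Lemma ratio_le_of_angles :
  (1 - k) ^+ 2 * (h1 T * h2 T * hT T) <= 32 * span_volume T.
Proof.
have [ o [i [j [l [U ij il]]]]] : exists o i j l, [/\ uniq [:: o; i; j; l],
    dist (q o) (q i) <= dist (q o) (q j) &
    dist (q o) (q i) <= dist (q o) (q l)].
  have U4 : uniq [:: inord 0; inord 1; inord 2; inord 3 : 'I_4].
    by rewrite /= !inE -!val_eqE /= !inordK.
  move: U4; set o := inord 0; set a := inord 1; set b := inord 2.
  set c := inord 3 => U4; exists o.
  have [Ub _ _ Uc] := uniq_perm4 U4.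
  have [ab|/ltW ba] := lerP (dist (q o) (q a)) (dist (q o) (q b)).
    have [ac|/ltW ca] := lerP (dist (q o) (q a)) (dist (q o) (q c)).
      by exists a, b, c.
    by exists c, a, b; split=> //; exact: le_trans ab.
  have [bc|/ltW cb] := lerP (dist (q o) (q b)) (dist (q o) (q c)).
    by exists b, a, c.
  by exists c, a, b; split=> //; exact: le_trans cb ba.
have [k0 k1] := andP k01.
have [_ Ulj Ujl Uli] := uniq_perm4 U.
have law := dihedral_law U.
have n1 := cross_edges_neq0 T Ujl; have n2 := cross_edges_neq0 T Uli.
have n3 := cross_edges_neq0 T U.
have good_j := ratio_le_of_good_edge U ij.
have good_l := ratio_le_of_good_edge Ulj il.
rewrite -/q in n1 n2 n3.
move: law n1 n2 n3 good_j good_l.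
set u := q i - q o; set v := q j - q o; set w := q l - q o => law n1 n2 n3.
have crossC (x y z : 'rV[R]_3) :
    dot (cross x y) (cross y z) = - dot (cross y x) (cross y z).
  by rewrite /cross !vecE/=; ring.
move=> good_j good_l.
have [|H|H] := antipodal_normals n1 n2 n3 (k := k).
- by rewrite crossC dotC (enorm_crossC w u) [enorm _ * _]mulrC; move: law; lra.
- apply: good_l; move: H.
  by rewrite crossC (enorm_crossC v w) dotC [enorm _ * _]mulrC; lra.
apply: good_j; move: H.
by rewrite dotC crossC (enorm_crossC u v) [enorm _ * _]mulrC; lra.
Qed.

End BoundedAngles.
End AnglesToRatio.

(** The diameter cancels because it is positive. *)
Lemma ratioE (R : realType) (T : tetrahedron R) :
  RT T / hT T = h1 T * h2 T * hT T / volume (tetra_set T).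
Proof.
rewrite /RT mulfK// gt_eqF//.
have U : uniq [:: inord 0; inord 1; inord 2; inord 3 : 'I_4].
  by rewrite /= !inE -!val_eqE /= !inordK.
apply: lt_le_trans (dist_le_hT T (inord 1) (inord 0)).
by rewrite enorm_gt0; exact: edge_neq0 U.
Qed.

Theorem theorem7 (R : realType) :
  (forall theta : R, pi / 2 <= theta < pi ->
     exists D : R, forall T : tetrahedron R,
       max_angle_condition theta T -> RT T / hT T <= D) /\
  (forall D : R,
     exists theta : R, pi / 2 <= theta < pi /\
       forall T : tetrahedron R,
         RT T / hT T <= D -> max_angle_condition theta T).
Proof.
split=> [theta /andP[th1 th2]|D].
  pose k := - cos theta; exists (27 * 32 / (1 - k) ^+ 2) => T.
  have pi0 : 0 < pi :> R := pi_gt0 R.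
  have thetaE : theta = acos (- k).
    by rewrite /k opprK cosK// in_itv/=; apply/andP; split; lra.
  have k1 : k < 1.
    rewrite /k ltrNl -cospi ltr_cos// in_itv/=; apply/andP; split; lra.
  have k0 : 0 <= k.
    rewrite /k oppr_ge0 -(cos_pihalf R) leNgt ltr_cos -?leNgt// in_itv/=;
      apply/andP; split; lra.
  rewrite thetaE => -[faces dihedrals].
  have := ratio_le_of_angles _ faces dihedrals.
  rewrite k0 k1 => /(_ isT) H.
  rewrite ratioE; have /andP[v1 v2] := volume_bounds T.
  have W0 := span_volume_gt0 T.
  have v0 : 0 < volume (tetra_set T) by apply: lt_le_trans v1; lra.
  have kk : 0 < (1 - k) ^+ 2 by rewrite exprn_gt0//; lra.
  by rewrite ler_pdivrMr// [leRHS]mulrAC ler_pdivlMr// [leLHS]mulrC; lra.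
pose D' := Num.max D 1; exists (acos (- cos_gap D')).
have D'1 : 1 <= D' by rewrite le_max lexx orbT.
have /andP[g0 g1] := cos_gap_itv D'1.
split.
  by rewrite -acos0 ler_acos ?acos_ltpi ?andbT; lra.
move=> T; rewrite ratioE; have /andP[v1 v2] := volume_bounds T.
have W0 := span_volume_gt0 T.
have v0 : 0 < volume (tetra_set T) by apply: lt_le_trans v1; lra.
rewrite ler_pdivrMr// => H.
have {}H : h1 T * h2 T * hT T <= D' * span_volume T.
  apply: le_trans H _; apply: le_trans (_ : D' * volume (tetra_set T) <= _).
    by rewrite ler_pM2r// le_max lexx.
  by rewrite ler_pM2l//; lra.
split=> [i j l|i j l m] U.
  exact: face_angle_le_of_ratio.
exact: dihedral_angle_le_of_ratio.
Qed.
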